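(* Let $G$ be a 3-connected graph that contains a non-degenerate vertex-2-edge-separator $(c,e_1,e_2)$. (a) If $c$ is incident to an edge $e_0\in E(G)$ such that $G-e_0-e_1-e_2$ is disconnected with components $C_1$ and $C_2$, let $u_i$ (resp. $v_i$) denote the endvertex of $e_i$ in $C_1$ (resp. $C_2$) for $i\in\{0,1,2\}$, and let $G_1$ (resp. $G_2$) be the graph obtained from $G[V(C_1)]$ (resp. $G[V(C_2)]$) by adding a new vertex $x_1$ (resp. $x_2$) and the edges $u_ix_1$ (resp. $v_ix_2$) for $i\in\{0,1,2\}$. (b) Otherwise, $G-e_1-e_2-c$ has exactly two components $C_1,C_2$; let $u_i$ (resp. $v_i$) be the endvertex of $e_i$ in $C_1$ (resp. $C_2$) for $i\in\{1,2\}$, and let $G_1$ (resp. $G_2$) be obtained from $G[V(C_1)\cup\{c\}]$ (resp. $G[V(C_2)\cup\{c\}]$) by adding a new vertex $x_1$ (resp. $x_2$) and the edges $u_1x_1,u_2x_1,cx_1$ (resp. $v_1x_2,v_2x_2,cx_2$). If $G$ is critical 2.5-connected, then (in either case) $G_1$ and $G_2$ are critical 2.5-connected, 3-connected graphs with fewer vertices than $G$.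
   Context: Graphs are finite, may have parallel edges, no loops. Biconnected: connected and for all pairwise distinct $u,v,w$ there is a $u$-$v$ path avoiding $w$. A biconnected graph $H$ (not a triangle) is 2.5-connected if there is no $(c,e)\in V(H)\times E(H)$ with $H-e-c$ disconnected. A vertex-2-edge-separator of a biconnected graph $H$ is a triple $(c,e_1,e_2)\in V(H)\times E(H)^2$ with $H-e_1-e_2-c$ disconnected. It is degenerate if there is a vertex $u$ of degree 3 whose incident edges are $e_0,e_1,e_2$ and $c$ is the other endvertex of $e_0$; otherwise non-degenerate. $H$ is critical 2.5-connected if it is 2.5-connected and $H-e$ is not 2.5-connected for every $e\in E(H)$. *)

(* Defs.v *)
From mathcomp Require Import all_boot.
Set Implicit Arguments. Unset Strict Implicit. Unset Printing Implicit Defensive.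

Record mgraph := MGraph {
  vt : finType; et : finType;
  vs : {set vt}; es : {set et};
  src : et -> vt; tgt : et -> vt }.

Definition wf (G : mgraph) : Prop :=
  forall e, e \in es G -> [/\ src e \in vs G, tgt e \in vs G & src e != tgt e].

Definition incident (G : mgraph) (e : et G) (v : vt G) : bool :=
  (src e == v) || (tgt e == v).

Definition joins (G : mgraph) (e : et G) (x y : vt G) : bool :=
  ((src e == x) && (tgt e == y)) || ((src e == y) && (tgt e == x)).

Definition adj (G : mgraph) (S : {set vt G}) (F : {set et G}) : rel (vt G) :=
  fun x y => [exists e in F, [&& src e \in S, tgt e \in S & joins e x y]].

Definition connected_sub (G : mgraph) (S : {set vt G}) (F : {set et G}) : Prop :=
  forall x y, x \in S -> y \in S -> connect (adj S F) x y.

Definition connectedG (G : mgraph) : Prop := connected_sub (vs G) (es G).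

Definition biconnected (G : mgraph) : Prop :=
  connectedG G /\
  forall u v w, u \in vs G -> v \in vs G -> w \in vs G ->
    u != v -> u != w -> v != w -> connect (adj (vs G :\ w) (es G)) u v.

Definition triangle (G : mgraph) : Prop :=
  [/\ #|vs G| = 3, #|es G| = 3 &
      forall u v, u \in vs G -> v \in vs G -> u != v ->
        exists2 e, e \in es G & joins e u v].

Definition two_five_connected (G : mgraph) : Prop :=
  [/\ biconnected G, ~ triangle G &
      forall c e, c \in vs G -> e \in es G -> connected_sub (vs G :\ c) (es G :\ e)].

Definition delete_edge (G : mgraph) (e : et G) : mgraph :=
  @MGraph (vt G) (et G) (vs G) (es G :\ e) (@src G) (@tgt G).

Definition critical_two_five (G : mgraph) : Prop :=
  two_five_connected G /\
  forall e, e \in es G -> ~ two_five_connected (delete_edge e).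

Definition three_connected (G : mgraph) : Prop :=
  3 < #|vs G| /\
  forall S : {set vt G}, S \subset vs G -> #|S| <= 2 -> connected_sub (vs G :\: S) (es G).

Definition v2e_separator (G : mgraph) (c : vt G) (e1 e2 : et G) : Prop :=
  [/\ c \in vs G, e1 \in es G, e2 \in es G &
      ~ connected_sub (vs G :\ c) (es G :\: [set e1; e2])].

Definition degenerate (G : mgraph) (c : vt G) (e1 e2 : et G) : Prop :=
  exists u, exists e0,
    [/\ u \in vs G, e0 \in es G,
        [set e in es G | incident e u] = [set e0; e1; e2],
        #|[set e in es G | incident e u]| = 3 & joins e0 u c].

Definition is_component (G : mgraph) (S : {set vt G}) (F : {set et G}) (C : {set vt G}) : Prop :=
  exists2 x, x \in S & C = [set y in S | connect (adj S F) x y].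

Definition two_components (G : mgraph) (S : {set vt G}) (F : {set et G})
    (C1 C2 : {set vt G}) : Prop :=
  [/\ is_component S F C1, is_component S F C2, C1 != C2 & S \subset C1 :|: C2].

Definition endin (G : mgraph) (C : {set vt G}) (e : et G) : vt G :=
  if src e \in C then src e else tgt e.

(* G[C] plus a new vertex x (= None) joined by three new edges to a0, a1, a2 *)
Definition extend (G : mgraph) (C : {set vt G}) (a0 a1 a2 : vt G) : mgraph :=
  let att (i : 'I_3) := if val i == 0 then a0 else if val i == 1 then a1 else a2 in
  @MGraph (option (vt G)) (et G + 'I_3)%type
    [set x : option (vt G) | if x is Some v then v \in C else true]
    [set f : (et G + 'I_3)%type |
       match f with inl e => [&& e \in es G, src e \in C & tgt e \in C]
                  | inr _ => true end]
    (fun f => match f with inl e => Some (src e) | inr i => Some (att i) end)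
    (fun f => match f with inl e => Some (tgt e) | inr _ => None end).

Definition buildA (G : mgraph) (C : {set vt G}) (e0 e1 e2 : et G) : mgraph :=
  extend C (endin C e0) (endin C e1) (endin C e2).

Definition buildB (G : mgraph) (C : {set vt G}) (c : vt G) (e1 e2 : et G) : mgraph :=
  extend (C :|: [set c]) (endin C e1) (endin C e2) c.

Definition good_piece (G H : mgraph) : Prop :=
  [/\ wf H, critical_two_five H, three_connected H & #|vs H| < #|vs G|].

(* Main.v *)
Require Import Defs.
From mathcomp Require Import all_boot.
Set Implicit Arguments. Unset Strict Implicit. Unset Printing Implicit Defensive.

(**
Each piece is [G] with one side of the separation contracted to a new vertex of
degree 3, so a vertex cut of a piece avoiding the new vertex lifts to [G]; one
containing it would isolate part of a side by too few vertices and edges of [G].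
As 3-connectedness implies 2.5-connectedness, criticality means that every edge
[f] lies in a vertex-2-edge-separator [(c', f, f')].  Edges at the new vertex lie
in a degenerate one.  For an old edge [f], take the separator of [G] containing
it: if [c'] is on the contracted side, replace it by the new vertex; if the
contracted side is not split, contract it.  If it is split, counting the edges
that leave its parts contradicts the connectivity of [G], except when [c' = c] in
case (b), where [f] and a new edge form a separator together with [c].
*)

(** All the counting rests on three facts about [G]: no two vertices, no vertex with an edge, and no
    two edges separate it. Criticality is used for the separators and also to exclude parallel
    edges. Non-degeneracy enters only through the fact that [e1] and [e2] have distinct ends on each
    side, and the failure of case (a) only through the fact that [c] sends at least two edges to
    each side.

    The exception [c' = c] of case (b) cannot be excluded by counting. There [f] splits one side and
    [f'] the other, and the four resulting parts of [G - c] are joined in a cycle by [f], [e1],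
    [f'], [e2], which is compatible with the connectivity of [G]. Contracting the side split by [f']
    closes this cycle at the new vertex, so an edge at the new vertex has to take over the role of
    [f']. *)

Lemma card_gt3_avoid (T : finType) (S : {set T}) a b c :
  3 < #|S| -> exists z, [/\ z \in S, z != a, z != b & z != c].
Proof.
move=> S3; have /card_gt0P [z] : 0 < #|S :\: [set a; b; c]|.
  rewrite cardsD subn_gt0; apply: leq_ltn_trans (subset_leq_card (subsetIr _ _)) _.
  apply: leq_ltn_trans (leq_card_setU _ _) (leq_ltn_trans _ S3).
  by rewrite cards2 cards1 addn1; case: (a != b).
rewrite !inE !negb_or => /andP [/andP [/andP [za zb] zc] zS].
by exists z.
Qed.

(** * Connectivity by cuts *)

Section Cuts.
Variable G : mgraph.
Implicit Types (S X : {set vt G}) (F : {set et G}).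

Lemma joinsC (e : et G) x y : joins e x y = joins e y x.
Proof. by rewrite /joins orbC. Qed.

Lemma joins_srctgt (e : et G) : joins e (src e) (tgt e).
Proof. by rewrite /joins !eqxx. Qed.

Lemma joins_ends (e : et G) x y : joins e x y ->
  (src e = x /\ tgt e = y) \/ (src e = y /\ tgt e = x).
Proof. by case/orP=> /andP [/eqP-> /eqP->]; [left|right]. Qed.

Lemma joins_inj (e : et G) x y x' y' : joins e x y -> joins e x' y' ->
  (x = x' /\ y = y') \/ (x = y' /\ y = x').
Proof.
move=> /joins_ends h /joins_ends h'.
by case: h h' => [[-> ->]|[-> ->]] [[-> ->]|[-> ->]]; [left|right|right|left].
Qed.

Lemma joins_incident (e : et G) x : incident e x -> exists y, joins e x y.
Proof.
case/orP=> /eqP <-; first by exists (tgt e); apply: joins_srctgt.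
by exists (src e); rewrite joinsC; apply: joins_srctgt.
Qed.

Lemma incident_joins (e : et G) x y : joins e x y -> incident e x.
Proof. by move/joins_ends => [[<- _]|[_ <-]]; rewrite /incident eqxx ?orbT. Qed.

Lemma wf_joins : wf G -> forall (e : et G) x y, e \in es G -> joins e x y ->
  [/\ x \in vs G, y \in vs G & x != y].
Proof.
move=> wfG e x y /wfG [h1 h2 h3] /joins_ends [[<- <-]|[<- <-]] //.
by rewrite eq_sym.
Qed.

Lemma endinE (C : {set vt G}) (e : et G) x y :
  joins e x y -> x \in C -> y \notin C -> endin C e = x.
Proof.
move=> /joins_ends [[h1 h2]|[h1 h2]] xC yC; rewrite /endin h1 ?xC //.
by rewrite (negPf yC) h2.
Qed.

(** [X] need not lie inside [S], so the same set can serve while vertices are removed from [S].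
    Closure in one direction suffices because [joins] is symmetric in the two ends. *)
Definition separates S F X : Prop :=
  [/\ exists2 x, x \in S & x \in X,
      exists2 y, y \in S & y \notin X
    & forall e x y, e \in F -> joins e x y -> x \in S -> y \in S ->
        x \in X -> y \in X].

Lemma adjP S F x y :
  reflect (exists e, [/\ e \in F, joins e x y, x \in S & y \in S]) (adj S F x y).
Proof.
apply: (iffP idP).
  case/existsP=> e /andP [eF /and3P [h1 h2 h]]; exists e; split=> //.
    by case: (joins_ends h) => [[<- _]|[_ <-]].
  by case: (joins_ends h) => [[_ <-]|[<- _]].
case=> e [eF h xS yS]; apply/existsP; exists e; rewrite eF h andbT /=.
by case: (joins_ends h) => [[-> ->]|[-> ->]]; rewrite xS yS.
Qed.

Lemma adjC S F : symmetric (adj S F).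
Proof.
move=> x y; apply/adjP/adjP => -[e [h1 h2 h3 h4]]; exists e; split=> //;
by rewrite joinsC.
Qed.

Lemma separates_disconnected S F X : separates S F X -> ~ connected_sub S F.
Proof.
case=> [[x xS xX] [y yS yX] hX] /(_ x y xS yS) cxy.
have clX : closed (adj S F) (mem X).
  apply: intro_closed; first by apply: sym_connect_sym; apply: adjC.
  by move=> u v /adjP [e [h1 h2 h3 h4]] uX; apply: (hX e u v).
by move: yX; rewrite -(closed_connect clX cxy) /= xX.
Qed.

Lemma connected_subP S F :
  reflect (connected_sub S F)
    [forall x in S, forall y in S, connect (adj S F) x y].
Proof.
apply: (iffP idP).
  by move=> /forall_inP h x y xS yS; move/forall_inP: (h x xS); apply.
by move=> h; apply/forall_inP => x xS; apply/forall_inP => y yS; apply: h.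
Qed.

Lemma disconnected_separates S F :
  ~ connected_sub S F -> exists X, separates S F X.
Proof.
move/connected_subP; rewrite negb_forall => /existsP [x].
rewrite negb_imply negb_forall => /andP [xS /existsP [y]].
rewrite negb_imply => /andP [yS nxy].
exists [set z | connect (adj S F) x z]; split.
- by exists x; rewrite // inE.
- by exists y; rewrite // inE.
- move=> e u v eF h uS vS; rewrite !inE => cxu; apply: connect_trans cxu _.
  by apply/connect1/adjP; exists e.
Qed.

Lemma connected_sub_cuts S F :
  (forall X, ~ separates S F X) -> connected_sub S F.
Proof.
move=> h; apply/connected_subP/negPn/negP => /connected_subP.
by case/disconnected_separates => X /h.
Qed.

(** Any third vertex besides the two witnesses can be deleted. This turns a disconnection into one
    with a deleted vertex, the form that the connectivity hypotheses exclude. *)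
Lemma separates_drop_vertex S F X :
  2 < #|S| -> separates S F X -> exists2 s, s \in S & separates (S :\ s) F X.
Proof.
move=> cS [[x xS xX] [y yS yX] hX].
have nxy : x != y by apply: contraNneq yX => <-.
have /card_gt0P [s] : 0 < #|S :\: [set x; y]|.
  rewrite cardsD subn_gt0; apply: leq_ltn_trans (subset_leq_card (subsetIr _ _)) _.
  by rewrite cards2 nxy.
rewrite !inE negb_or => /andP [/andP [sx sy] sS].
exists s => //; split; first by exists x; rewrite // !inE eq_sym sx.
  by exists y; rewrite // !inE eq_sym sy.
move=> e u v eF h; rewrite !inE => /andP [_ uS] /andP [_ vS].
exact: (hX e u v).
Qed.

(** The vertices [a] and [b] may coincide, so cuts by a single vertex are covered as well. *)
Lemma three_connected_separates a b X :
  three_connected G -> a \in vs G -> b \in vs G ->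
  ~ separates (vs G :\: [set a; b]) (es G) X.
Proof.
move=> [_ h3] aV bV /separates_disconnected; apply; apply: h3.
  by apply/subsetP => z; rewrite !inE => /orP [] /eqP ->.
by rewrite cards2; case: (a != b).
Qed.

Lemma three_connected_no_vertex_cut a b X x0 y0 :
  three_connected G -> a \in vs G -> b \in vs G ->
  x0 \in vs G -> x0 != a -> x0 != b -> x0 \in X ->
  y0 \in vs G -> y0 != a -> y0 != b -> y0 \notin X ->
  (forall g x y, g \in es G -> joins g x y -> x != a -> x != b -> y != a ->
     y != b -> x \in X -> y \in X) -> False.
Proof.
move=> h3 aV bV x0V x0a x0b x0X y0V y0a y0b y0X hX.
apply: (@three_connected_separates a b X h3 aV bV); split.
- by exists x0; rewrite // !inE negb_or x0a x0b.
- by exists y0; rewrite // !inE negb_or y0a y0b.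
move=> e x y eE h; rewrite !inE !negb_or => /andP [/andP [xa xb] _].
by move=> /andP [/andP [ya yb] _]; apply: (hX e).
Qed.

(** If [(c, e)] separates, then [e] joins the two sides, as otherwise [c] alone separates. A fourth
    vertex [z] lies on the side of one end [a] of [e], and then [c] and [a] separate [z] from the
    other end of [e]. *)
Lemma three_connected_two_five :
  wf G -> three_connected G -> two_five_connected G.
Proof.
move=> wfG h3c; have [c3 h3] := h3c.
split.
- split.
    by have := h3 set0 (sub0set _); rewrite cards0 setD0; apply.
  move=> u v w uV vV wV uv uw vw; apply: (h3 [set w]).
  + by rewrite sub1set.
  + by rewrite cards1.
  + by rewrite !inE uw.
  + by rewrite !inE vw.
- by case=> h; rewrite h in c3.
move=> c e cV eE; apply: connected_sub_cuts => X.
have wlogX (Y : {set vt G}) a b z : joins e a b -> a != c -> b != c ->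
    separates (vs G :\ c) (es G :\ e) Y -> a \in Y -> b \notin Y ->
    z \in vs G -> z != a -> z != b -> z != c -> z \in Y -> False.
  move=> jab ac bc [_ _ hY] aY bY zV za zb zc zY.
  have [aV bV ab] := wf_joins wfG eE jab.
  apply: (@three_connected_no_vertex_cut c a Y z b) => //.
    by rewrite eq_sym.
  move=> g x y gE jg xc xa yc ya xY; apply: (hY g x y) => //; rewrite ?inE ?xc ?yc /=.
  - rewrite gE andbT; apply: contraNneq xa => ge; rewrite ge in jg.
    by case: (joins_inj jab jg) => [[-> //]|[ay _]]; rewrite ay eqxx in ya.
  - by case: (wf_joins wfG gE jg).
  - by case: (wf_joins wfG gE jg).
move=> sX; have [[x xS xX] [y yS yX] hX] := sX.
have sXC : separates (vs G :\ c) (es G :\ e) (~: X).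
  split; first by exists y; rewrite // inE.
    by exists x; rewrite // inE negbK.
  move=> g u v gE jg uS vS; rewrite !inE; apply: contraNN.
  by apply: (hX g v u); rewrite // joinsC.
move: xS yS; rewrite !inE => /andP [xc xV] /andP [yc yV].
have ec a b : joins e a b -> a != c -> b != c -> (a \in X) != (b \in X) -> False.
  wlog : a b / (a \in X) && (b \notin X).
    move=> H jab ac bc; case aX: (a \in X); case bX: (b \in X) => // _.
      by apply: (H a b); rewrite ?aX ?bX.
    by apply: (H b a); rewrite ?aX ?bX // joinsC.
  move=> /andP [aX bX] jab ac bc _.
  have [aV bV ab] := wf_joins wfG eE jab.
  have [z [zV za zb zc]] := card_gt3_avoid a b c c3.
  case zX : (z \in X).
    exact: (wlogX X a b z).
  apply: (wlogX (~: X) b a z); rewrite ?inE ?zX ?negbK //.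
  by rewrite joinsC.
apply: (@three_connected_separates c c X h3c cV cV); rewrite setUid; split.
- by exists x; rewrite // !inE xc.
- by exists y; rewrite // !inE yc.
move=> g u v gE jg uS vS uX.
have [ge|ge] := eqVneq g e; last by apply: (hX g u v); rewrite // !inE ge.
apply/negPn/negP => vX; move: uS vS; rewrite !inE => /andP [uc _] /andP [vc _].
by apply: (ec u v); rewrite -?ge // uX (negPf vX).
Qed.

End Cuts.

(** * Small cuts in a critical 3-connected graph *)

Section Critical.
Variable G : mgraph.
Hypotheses (wfG : wf G) (G3 : three_connected G) (Gcrit : critical_two_five G).
Implicit Types (X : {set vt G}).

Lemma no_vertex_edge_cut c e X x0 y0 :
  c \in vs G -> e \in es G ->
  x0 \in vs G -> x0 != c -> x0 \in X -> y0 \in vs G -> y0 != c -> y0 \notin X ->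
  (forall g x y, g \in es G -> g != e -> joins g x y -> x != c -> y != c ->
     x \in X -> y \in X) -> False.
Proof.
move=> cV eE x0V x0c x0X y0V y0c y0X hX.
have [_ _ /(_ c e cV eE)] := three_connected_two_five wfG G3.
apply: (@separates_disconnected _ _ _ X); split.
- by exists x0; rewrite // !inE x0c.
- by exists y0; rewrite // !inE y0c.
move=> g x y; rewrite !inE => /andP [ge gE] jg /andP [xc _] /andP [yc _].
exact: (hX g).
Qed.

(** Deleting an end of [q] removes [q], so [p] and that end form a vertex-edge cut unless the end is
    one of the two witnesses. Hence [q] joins [x0] and [y0]; a further vertex [z] then replaces the
    witness on its own side, and an end of [q] becomes free to be deleted. *)
Lemma no_edge_cut p q X x0 y0 :
  p \in es G -> q \in es G ->
  x0 \in vs G -> x0 \in X -> y0 \in vs G -> y0 \notin X ->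
  (forall g x y, g \in es G -> g != p -> g != q -> joins g x y ->
     x \in X -> y \in X) -> False.
Proof.
move=> pE qE x0V x0X y0V y0X hX.
have avoid c d x y : joins q c d -> x \in vs G -> x \in X -> y \in vs G ->
    y \notin X -> x != c -> y != c -> False.
  move=> jq xV xX yV yX xc yc; have [cV _ _] := wf_joins wfG qE jq.
  apply: (@no_vertex_edge_cut c p X x y) => // g u v gE gp jg uc vc.
  apply: (hX g) => //; apply: contraNneq uc => gq; rewrite gq in jg.
  by case: (joins_inj jq jg) => [[-> //]|[cv _]]; rewrite cv eqxx in vc.
have jq := joins_srctgt q; have jq' := jq; rewrite joinsC in jq'.
have [z [zV zx zy _]] := card_gt3_avoid x0 y0 y0 (proj1 G3).
have endq d d' : joins q d d' -> d = x0 \/ d = y0.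
  move=> jd; have [|dx] := eqVneq d x0; first by left.
  have [|dy] := eqVneq d y0; first by right.
  by case: (avoid d d' x0 y0); rewrite // eq_sym.
have wlogq d : joins q x0 d -> d = y0 -> False.
  move=> jd dy; rewrite dy in jd; have [_ _ nxy] := wf_joins wfG qE jd.
  case zX: (z \in X); first by apply: (avoid x0 y0 z y0); rewrite // eq_sym.
  by apply: (avoid y0 x0 x0 z); rewrite // ?zX // joinsC.
have [_ _ nq] := wf_joins wfG qE jq.
case: (endq _ _ jq) => h1; case: (endq _ _ jq') => h2.
- by rewrite h1 h2 eqxx in nq.
- by apply: (wlogq (tgt q)) => //; rewrite -h1.
- by apply: (wlogq (src q)) => //; rewrite -h2.
- by rewrite h1 h2 eqxx in nq.
Qed.

(** Deleting [e] leaves a biconnected graph on more than three vertices, so the failure of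
    2.5-connectedness is a pair [(c, f)] that separates [G - e]. The edge [e] crosses the resulting
    cut, since otherwise [(c, f)] would separate [G] itself. *)
Lemma critical_cut e : e \in es G ->
  exists c f X x0 y0,
    [/\ c \in vs G, f \in es G, f != e & joins e x0 y0] /\
    [/\ x0 != c, y0 != c, x0 \in X & y0 \notin X] /\
    (forall g x y, g \in es G -> g != e -> g != f -> joins g x y ->
       x != c -> y != c -> (x \in X) = (y \in X)).
Proof.
move=> eE; have [_ /(_ e eE) n25] := Gcrit.
have h25 := three_connected_two_five wfG G3; have [_ _ hG] := h25.
pose conn c f := [forall x in vs G :\ c, forall y in vs G :\ c,
  connect (adj (vs G :\ c) (es G :\ e :\ f)) x y].
have [|nh] := boolP [forall c in vs G, forall f in es G :\ e, conn c f].
  move=> /forall_inP h; case: n25; split.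
  - split.
      (* A disconnection of [G - e] would survive the deletion of some vertex [s], and [(s, e)]
         would separate [G]. *)
      apply: (@connected_sub_cuts G) => X sX.
      have [s sV] := separates_drop_vertex (ltnW (proj1 G3)) sX.
      by move/separates_disconnected; apply; apply: hG.
    move=> u v w uV vV wV uv uw vw; apply: (hG w e wV eE).
      by rewrite !inE uw.
    by rewrite !inE vw.
  - by case=> h' _ _; move: (proj1 G3); rewrite -[vs G]/(vs (delete_edge e)) h'.
  - by move=> c f cV fE; apply/connected_subP; move/forall_inP: (h c cV); apply.
move: nh; rewrite negb_forall => /existsP [c].
rewrite negb_imply negb_forall => /andP [cV /existsP [f]].
rewrite negb_imply => /andP [fE]; rewrite !inE in fE; case/andP: fE => fe fE.
move/connected_subP/disconnected_separates => [X [[x xS xX] [y yS yX] hX]].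
have hX' g u v : g \in es G -> g != e -> g != f -> joins g u v ->
    u != c -> v != c -> (u \in X) = (v \in X).
  move=> gE ge gf jg uc vc; have [uV vV _] := wf_joins wfG gE jg.
  apply/idP/idP; first by apply: (hX g); rewrite // !inE ?ge ?gf ?uc ?vc.
  by rewrite joinsC in jg; apply: (hX g); rewrite // !inE ?ge ?gf ?uc ?vc.
move: xS yS; rewrite !inE => /andP [xc xV] /andP [yc yV].
have [/existsP [a /existsP [b /and5P [h1 h2 h3 h4 h5]]]|] :=
  boolP [exists a, exists b, [&& joins e a b, a != c, b != c, a \in X & b \notin X]].
  by exists c, f, X, a, b.
move=> nab; case: (@no_vertex_edge_cut c f X x y) => // g u v gE gf jg uc vc.
have [ge|ge] := eqVneq g e; last by rewrite (hX' g u v).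
move=> uX; apply: contraNT nab => vX; apply/existsP; exists u; apply/existsP.
by exists v; rewrite -ge jg uc vc uX.
Qed.

(** An edge [f] parallel to [e] crosses every cut that [e] crosses, so it is the second edge of the
    separator of [e]. Deleting [c] and either common end then removes all crossing edges, and a
    fourth vertex, on whichever side it lies, yields a separation of [G] by two vertices. *)
Lemma critical_simple e f a b :
  e \in es G -> f \in es G -> joins e a b -> joins f a b -> e = f.
Proof.
move=> eE fE je jf; apply/eqP/negPn/negP => nef; rewrite eq_sym in nef.
have [c [f' [X [x0 [y0 [[cV f'E f'e je0] [[x0c y0c x0X y0X] hX]]]]]]] :=
  critical_cut eE.
have {}jf : joins f x0 y0.
  by case: (joins_inj je je0) => [] [-> ->] in jf *; rewrite // joinsC.
have ff' : f = f'.
  apply/eqP/negPn/negP => nff'; move: y0X.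
  by rewrite -(hX f x0 y0) ?x0X.
have [x0V y0V nxy] := wf_joins wfG eE je0.
have [z [zV zx zy zc]] := card_gt3_avoid x0 y0 c (proj1 G3).
have cut g x y w : g \in es G -> joins g x y -> joins e w x0 || joins e w y0 ->
    x != c -> x != w -> y != c -> y != w -> (x \in X) = (y \in X).
  move=> gE jg jw xc xw yc yw.
  have hw : w = x0 \/ w = y0.
    by case/orP: jw => jw; case: (joins_inj jw je0) => [] [-> _]; auto.
  apply: (hX g) => //; apply: contraTneq jg => ->.
    apply/negP => jg; case: (joins_inj je0 jg) => [] [? ?]; subst;
    by case: hw => ?; subst; rewrite ?eqxx in xw yw.
  rewrite -ff'; apply/negP => jg; case: (joins_inj jf jg) => [] [? ?]; subst;
  by case: hw => ?; subst; rewrite ?eqxx in xw yw.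
case zX: (z \in X).
  apply: (@three_connected_no_vertex_cut G c x0 X z y0) => //; first by rewrite eq_sym.
  by move=> g x y gE jg xc xw yc yw; rewrite (cut g x y x0) // je0 orbT.
apply: (@three_connected_no_vertex_cut G c y0 X x0 z) => //; rewrite ?zX //.
move=> g x y gE jg xc xw yc yw; rewrite (cut g x y y0) //.
by rewrite (joinsC e y0) je0.
Qed.

End Critical.

(** * The graph obtained by attaching a vertex of degree 3 *)

(** This is the attachment map local to [extend], named so that statements can mention it; the two
    are convertible. *)
Definition triple (T : Type) (a0 a1 a2 : T) (i : 'I_3) : T :=
  if val i == 0 then a0 else if val i == 1 then a1 else a2.

Definition o0 : 'I_3 := ord0.
Definition o1 : 'I_3 := Ordinal (isT : 1 < 3).
Definition o2 : 'I_3 := Ordinal (isT : 2 < 3).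

Lemma ord3P (i : 'I_3) : [|| i == o0, i == o1 | i == o2].
Proof. by case: i => -[|[|[|]]]. Qed.

Lemma triple_fun (T : Type) (a : 'I_3 -> T) : triple (a o0) (a o1) (a o2) =1 a.
Proof. by move=> i; case/or3P: (ord3P i) => /eqP ->. Qed.

Lemma ord3_third (i j : 'I_3) : i != j ->
  exists k, [/\ i != k, j != k & forall l, [|| l == i, l == j | l == k]].
Proof.
case/or3P: (ord3P i) => /eqP ->; case/or3P: (ord3P j) => /eqP -> // _;
[exists o2|exists o1|exists o2|exists o0|exists o1|exists o0];
by split=> // l; move: (ord3P l); do 3 case: (l == _).
Qed.

(** Used when a cut [X] meets a cut of three edges: on the side of [X] opposite to the majority [b],
    at most the single edge with index [j] can leave. *)
Lemma ord3_majority (p : 'I_3 -> bool) : exists b j, forall i, i != j -> p i = b.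
Proof.
have [h|h] := eqVneq (p o0) (p o1).
  by exists (p o0), o2 => i; case/or3P: (ord3P i) => /eqP ->.
have [h'|h'] := eqVneq (p o0) (p o2).
  by exists (p o0), o1 => i; case/or3P: (ord3P i) => /eqP ->.
exists (p o1), o0 => i; case/or3P: (ord3P i) => /eqP -> // _.
by move: h h'; case: (p o0); case: (p o1); case: (p o2).
Qed.

Section Extend.
Variables (G : mgraph) (C : {set vt G}) (a0 a1 a2 : vt G).
Local Notation att := (triple a0 a1 a2).

Let H := extend C a0 a1 a2.

Lemma triple_inj : a0 != a1 -> a0 != a2 -> a1 != a2 -> injective att.
Proof.
move=> h01 h02 h12 i j; rewrite /triple => eqa; apply: val_inj; move: eqa.
case: i => -[|[|[|//]]] ? /=; case: j => -[|[|[|//]]] ? //= eqa;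
by rewrite eqa eqxx in h01 h02 h12 *.
Qed.

Lemma joins_old e x y : @joins H (inl e) x y ->
  exists u v, [/\ x = Some u, y = Some v & joins e u v].
Proof.
move/joins_ends => /= [[<- <-]|[<- <-]].
  by exists (src e), (tgt e); split=> //; apply: joins_srctgt.
by exists (tgt e), (src e); split=> //; rewrite joinsC joins_srctgt.
Qed.

Lemma joins_new i x y : @joins H (inr i) x y ->
  (x = Some (att i) /\ y = None) \/ (x = None /\ y = Some (att i)).
Proof. by move/joins_ends => /= [[<- <-]|[<- <-]]; [left|right]. Qed.

Lemma some_vs v : (Some v \in vs H) = (v \in C).
Proof. by rewrite inE. Qed.

Lemma none_vs : None \in vs H.
Proof. by rewrite inE. Qed.

Lemma inr_es i : inr i \in es H.
Proof. by rewrite inE. Qed.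

Lemma inl_es e : (inl e \in es H) = [&& e \in es G, src e \in C & tgt e \in C].
Proof. by rewrite inE. Qed.

Lemma inl_es_joins e x y : inl e \in es H -> joins e x y ->
  [/\ e \in es G, x \in C & y \in C].
Proof. by rewrite inl_es => /and3P [h1 h2 h3] /joins_ends [[<- <-]|[<- <-]]. Qed.

Lemma card_extend : #|vs H| = #|C|.+1.
Proof.
have -> : vs H = None |: (Some @: C).
  apply/setP => -[v|]; rewrite !inE //= mem_imset // => x y; exact: Some_inj.
rewrite cardsU1 card_imset; last exact: Some_inj.
by case: imsetP => // -[x _].
Qed.

(** * 3-connectedness and criticality of a piece *)

Hypotheses (wfG : wf G) (G3 : three_connected G) (CV : C \subset vs G).
Hypotheses (attC : forall i, att i \in C) (attI : injective att).
Hypothesis D2 : 1 < #|vs G :\: C|.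
Hypothesis boundary : forall e x y, e \in es G -> joins e x y ->
  x \in C -> y \notin C -> exists i, x = att i.

Lemma card_attached : 2 < #|C|.
Proof.
have : #|[set att i | i : 'I_3]| = 3 by rewrite card_imset // card_ord.
by move=> <-; apply: subset_leq_card; apply/subsetP => _ /imsetP [i _ ->].
Qed.

Lemma wf_extend : wf H.
Proof.
move=> [e|i].
  rewrite inl_es /= => /and3P [eE sC tC]; rewrite !some_vs; split=> //.
  have [_ _ h] := wfG eE; apply: contraNneq h => -[->].
  by rewrite eqxx.
by move=> _; rewrite [src _]/= [tgt _]/= some_vs none_vs; split=> //; apply: attC.
Qed.

Lemma card_extend_lt : #|vs H| < #|vs G|.
Proof.
rewrite card_extend -(cardsID C (vs G)) (setIidPr CV).
by rewrite -addn2 leq_add2l.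
Qed.

Lemma extend_three_connected :
  (forall s X, s \in C -> ~ separates (C :\ s) (es G) X) -> three_connected H.
Proof.
move=> noC; split; first by rewrite card_extend ltnS card_attached.
move=> S SV S2; apply: connected_sub_cuts => X sX.
have [sN|sN] := boolP (None \in S); last first.
  (* contracting the complement of [C] to the new vertex maps [G] onto [H] *)
  pose T := [set v | Some v \in S].
  pose Y := [set v | if v \in C then Some v \in X else None \in X].
  have TV : T \subset vs G.
    apply/subsetP => v; rewrite inE => /(subsetP SV); rewrite some_vs.
    exact: (subsetP CV).
  have TC v : v \in T -> v \in C.
    by rewrite inE => /(subsetP SV); rewrite some_vs.
  have T2 : #|T| <= 2.
    apply: leq_trans S2; rewrite -(card_imset T Some_inj).
    by apply: subset_leq_card; apply/subsetP => _ /imsetP [v + ->]; rewrite inE.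
  have /card_gt0P [d] : 0 < #|vs G :\: C| by apply: ltnW.
  rewrite inE => /andP [dC dV].
  apply: (@separates_disconnected _ _ _ Y) (proj2 G3 T TV T2).
  have lift (b : bool) z : z \in vs H :\: S -> (z \in X) = b ->
      exists2 v, v \in vs G :\: T & (v \in Y) = b.
    case: z => [v|]; rewrite inE => /andP [zS].
      rewrite some_vs => vC zb; exists v; last by rewrite inE vC.
      by rewrite !inE zS (subsetP CV).
    move=> _ zb; exists d; last by rewrite inE (negPf dC).
    by rewrite inE dV andbT; apply: contra dC; apply: TC.
  case: sX => [[x xS xX] [y yS /negPf yX] hX]; split.
  - by have [v] := lift true x xS xX; exists v.
  - by have [v h1 h2] := lift false y yS yX; exists v; rewrite ?h2.
  (* An edge of [G] leaving [C] starts at an attachment vertex. Unless that vertex is deleted, its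
     new edge puts it on the side of the new vertex, which is the side given to everything outside
     [C]. *)
  have step i : att i \notin T -> (Some (att i) \in X) = (None \in X).
    rewrite inE => zT.
    have VN : None \in vs H :\: S by rewrite inE sN none_vs.
    have Va : Some (att i) \in vs H :\: S by rewrite inE zT some_vs attC.
    have j1 : @joins H (inr i) (Some (att i)) None by rewrite /joins /= !eqxx.
    have j2 := j1; rewrite joinsC in j2.
    by apply/idP/idP; [apply: (hX _ _ _ (inr_es i) j1)|apply: (hX _ _ _ (inr_es i) j2)].
  move=> e u v eE je; rewrite [u \in _]inE [v \in _]inE => /andP [uT uV] /andP [vT vV].
  rewrite !inE; case uC: (u \in C); case vC: (v \in C) => //.
  + apply: (hX (inl e)).
    * rewrite inl_es eE; case: (joins_ends je) => [[-> ->]|[-> ->]];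
      by rewrite uC vC.
    * by case: (joins_ends je) => [[h1 h2]|[h1 h2]]; rewrite /joins /= h1 h2 !eqxx ?orbT.
    * by move: uT; rewrite !inE uC => ->.
    * by move: vT; rewrite !inE vC => ->.
  + have [i ui] := boundary eE je uC (negbT vC).
    by rewrite ui step // -ui.
  + rewrite joinsC in je; have [i vi] := boundary eE je vC (negbT uC).
    by rewrite vi step // -vi.
(* The new vertex is deleted, so every surviving edge is an edge of [G] inside [C], and [S] contains
   at most one vertex of [C]. *)
pose Y := [set v | Some v \in X].
have sub (T : {set vt G}) : (forall v, v \in T -> v \in C /\ Some v \notin S) ->
    (forall z, z \in vs H :\: S -> exists2 v, z = Some v & v \in T) ->
    separates T (es G) Y.
  case: sX => [[x xS xX] [y yS yX] hX] hT hT'; split.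
  - by have [v xv vT] := hT' x xS; exists v; rewrite // inE -xv.
  - by have [v xv vT] := hT' y yS; exists v; rewrite // inE -xv.
  move=> e u v eE je /hT [uC uS] /hT [vC vS]; rewrite !inE.
  apply: (hX (inl e)).
  * rewrite inl_es eE; case: (joins_ends je) => [[-> ->]|[-> ->]];
    by rewrite uC vC.
  * by case: (joins_ends je) => [[h1 h2]|[h1 h2]]; rewrite /joins /= h1 h2 !eqxx ?orbT.
  * by rewrite inE uS some_vs.
  * by rewrite inE vS some_vs.
have [/existsP [s sS]|ns] := boolP [exists s, Some s \in S].
  have sC : s \in C by rewrite -some_vs; apply: (subsetP SV).
  apply: (noC s Y sC); apply: sub => [v|[v|]].
  - rewrite !inE => /andP [vs ->]; split=> //; apply/negP => vS.
    have : [set None; Some s; Some v] \subset S.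
      by apply/subsetP => z; rewrite !inE => /orP [/orP [] |] /eqP ->.
    move/subset_leq_card => h; have := leq_trans h S2.
    by rewrite -setUA cardsU1 cards2 !inE /= (inj_eq Some_inj) eq_sym vs.
  - rewrite !inE => /andP [vS vC]; exists v => //; rewrite !inE vC andbT.
    by apply: contraNneq vS => ->.
  - by rewrite inE sN.
(* Only the new vertex is deleted; another vertex [s] is dropped to reach the excluded form. *)
have [] := @separates_drop_vertex G C (es G) Y card_attached.
  apply: sub => [v vC|[v|]].
  - by split=> //; apply: contra ns => vS; apply/existsP; exists v.
  - by rewrite inE some_vs => /andP [_ vC]; exists v.
  - by rewrite inE sN.
by move=> s sC /(noC s Y sC).
Qed.

(* In terms of [G], the edge [f] of [H] lies in a vertex-2-edge-separator of [H]
   whose vertex is the new one (first case) or [c] (second case); [b] says on which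
   side of [X] the new vertex is put. *)
Definition piece_separator (f : et G) : Prop :=
  (exists X g, separates C (es G :\: [set f; g]) X) \/
  (exists c (X : {set vt G}) x0 y0 (b : bool) h,
     [/\ c \in C, joins f x0 y0, h \in es H & h != inl f] /\
     [/\ x0 != c, y0 != c, x0 \in X & y0 \notin X] /\
     (forall g x y, g \in es G -> g != f -> inl g != h -> joins g x y ->
        x \in C -> y \in C -> x != c -> y != c -> (x \in X) = (y \in X)) /\
     (forall i, inr i != h -> att i != c -> (att i \in X) = b)).

Lemma extend_critical : three_connected H ->
  (forall f, f \in es G -> src f \in C -> tgt f \in C -> piece_separator f) ->
  critical_two_five H.
Proof.
move=> H3 hsep; split; first exact: three_connected_two_five wf_extend H3.
move=> f fE [_ _ n25].
have {}n25 c h X : c \in vs H -> h \in es H -> h != f ->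
    separates (vs H :\ c) (es H :\ f :\ h) X -> False.
  move=> cV hE hf /separates_disconnected; apply; apply: (n25 c h cV).
  by rewrite inE in_set1 hf.
case: f fE n25 => [f|i] fE n25.
  move: (fE); rewrite inl_es => /and3P [fG sC tC].
  case: (hsep f fG sC tC) => [[X [g sX]]|].
    (* The second edge must be an edge of the piece other than [f]. When [g] does not qualify,
       [inr o0] is a harmless choice: it disappears together with the new vertex. *)
    pose h : et H := if (inl g \in es H) && (g != f) then inl g else inr o0.
    have hE : h \in es H by rewrite /h; case: ifP => [/andP [] //|_]; apply: inr_es.
    have hf : h != inl f.
      by rewrite /h; case: ifP => [/andP [_ gf]|_] //; apply: contraNneq gf => -[->].
    apply: (n25 None h (Some @: X) none_vs hE hf).
    case: sX => [[x xC xX] [y yC yX] hX]; split.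
    - exists (Some x); last by rewrite mem_imset //; apply: Some_inj.
      by rewrite inE some_vs xC inE.
    - exists (Some y); last by rewrite mem_imset //; apply: Some_inj.
      by rewrite inE some_vs yC inE.
    move=> [e|i] u v; rewrite inE in_set1 => /andP [eh]; rewrite inE in_set1.
      move=> /andP [ef eE] /joins_old [x' [y' [-> -> je]]] _ _.
      have [eG x'C y'C] := inl_es_joins eE je.
      rewrite !mem_imset; try exact: Some_inj.
      apply: (hX e) => //; rewrite !inE eG andbT negb_or; apply/andP; split.
        by apply: contraNneq ef => ->.
      apply: contraNneq eh => eg; rewrite /h -eg eE /=.
      by have -> : e != f by apply: contraNneq ef => ->.
    by move=> _ /joins_new [[-> ->]|[-> ->]]; rewrite !inE eqxx.
  case=> c [X [x0 [y0 [b [h [[cC jf hE hf] [[x0c y0c x0X y0X] [hX ha]]]]]]]].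
  have [_ x0C y0C] := inl_es_joins fE jf.
  pose Y := [set z : vt H | if z is Some v then v \in X else b].
  apply: (n25 (Some c) h Y) => //; first by rewrite some_vs.
  split.
  - by exists (Some x0); rewrite !inE //= x0C andbT; apply: contraNneq x0c => -[->].
  - by exists (Some y0); rewrite !inE //= y0C andbT; apply: contraNneq y0c => -[->].
  have neqS (v : vt G) : Some v != Some c -> v != c by apply: contraNneq => ->.
  move=> [e|i] u v; rewrite inE in_set1 => /andP [eh]; rewrite inE in_set1.
    move=> /andP [ef eE] /joins_old [x' [y' [-> -> je]]].
    have [eG x'C y'C] := inl_es_joins eE je.
    rewrite inE in_set1 => /andP [/neqS xc _].
    rewrite inE in_set1 => /andP [/neqS yc _].
    rewrite ![_ \in Y]inE => ?; rewrite -(hX e x' y') //.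
  move=> /andP [_ _] /joins_new [] [-> ->].
    rewrite inE in_set1 => /andP [/neqS xc _] _.
    by rewrite ![_ \in Y]inE ha.
  move=> _; rewrite inE in_set1 => /andP [/neqS xc _].
  by rewrite ![_ \in Y]inE ha.
(* the new vertex has degree 3, so each of its edges is in a degenerate separator *)
have [j ij] : exists j, i != j.
  by case/or3P: (ord3P i) => /eqP ->; [exists o1|exists o0|exists o0].
have [k [ik jk ijk]] := ord3_third ij.
apply: (n25 (Some (att j)) (inr k) [set None]); rewrite ?some_vs ?inr_es //.
  by apply: contraNneq ik => -[->].
split.
- by exists None; rewrite ?inE.
- exists (Some (att i)); rewrite ?inE // attC andbT (inj_eq Some_inj).
  by rewrite (inj_eq attI).
move=> [e|l] u v.
  by move=> _ /joins_old [x' [y' [-> -> _]]]; rewrite !inE.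
rewrite inE in_set1 => /andP [lk]; rewrite inE in_set1 => /andP [li _].
case/joins_new => [] [-> ->]; first by rewrite [Some _ \in [set _]]inE.
case/or3P: (ijk l) => /eqP h; rewrite h ?eqxx in li lk *; try done.
by rewrite !inE eqxx.
Qed.

(** The new vertex takes the common side [b] of all vertices outside [C]. An attachment vertex is on
    that side too if an edge other than [f'] takes it out of [C]. The second hypothesis says that a
    single edge can spoil this for at most one index [j]. *)
Lemma contracted_piece_separator c f f' (X : {set vt G}) x0 y0 (b : bool) :
  (forall i, exists g d, [/\ g \in es G, joins g (att i) d & d \notin C]) ->
  (forall g, g \in es G -> exists j, forall i, i != j ->
     exists g' d, [/\ g' \in es G, g' != g, joins g' (att i) d & d \notin C]) ->
  src f \in C -> tgt f \in C ->
  c \in C -> f' \in es G -> f' != f -> joins f x0 y0 ->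
  x0 != c -> y0 != c -> x0 \in X -> y0 \notin X ->
  (forall g x y, g \in es G -> g != f -> g != f' -> joins g x y ->
     x != c -> y != c -> (x \in X) = (y \in X)) ->
  (forall d, d \in vs G -> d \notin C -> (d \in X) = b) ->
  piece_separator f.
Proof.
move=> K0 K fs ft cC f'E f'f jf x0c y0c x0X y0X hX hb; right.
have notC g x d : joins g x d -> d \notin C -> src g \in C -> tgt g \in C -> False.
  by move=> /joins_ends [[_ ->]|[-> _]] /negPf ->.
have side i g d : g \in es G -> g != f' -> joins g (att i) d -> d \notin C ->
    att i != c -> (att i \in X) = b.
  move=> gE gf' jg dC ac; have [_ dV _] := wf_joins wfG gE jg.
  rewrite -(hb d dV dC); apply: (hX g) => //.
    by apply/eqP => gf; apply: (notC g _ d jg dC); rewrite gf.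
  by apply: contraNneq dC => ->.
have [f'C|f'C] := boolP (inl f' \in es H).
  exists c, X, x0, y0, b, (inl f'); do !split=> //.
    by move=> g x y gE gf gf' jg xC yC xc yc; apply: (hX g).
  move=> i _ ac; have [g [d [gE jg dC]]] := K0 i.
  apply: (side i g d) => //; apply/eqP => gf'.
  by move: f'C; rewrite inl_es -gf' => /and3P [_]; apply: (notC g _ d jg dC).
(* Here [f'] does not survive in the piece; the new edge at the one attachment vertex that may
   depend on [f'] replaces it. *)
have [j hj] := K f' f'E.
exists c, X, x0, y0, b, (inr j); do !split=> //; first by rewrite inr_es.
- move=> g x y gE gf _ jg xC yC xc yc; apply: (hX g) => //.
  apply: contraNneq f'C => gf'; rewrite -gf' inl_es gE.
  by case: (joins_ends jg) => [] [-> ->]; rewrite xC yC.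
move=> i ij ac; have [|g [d [gE gf' jg dC]]] := hj i.
  by apply: contraNneq ij => ->.
exact: (side i g d).
Qed.

Lemma extend_good_piece :
  (forall s X, s \in C -> ~ separates (C :\ s) (es G) X) ->
  (forall f, f \in es G -> src f \in C -> tgt f \in C -> piece_separator f) ->
  good_piece G H.
Proof.
move=> noC hsep; have H3 := extend_three_connected noC.
split=> //; [exact: wf_extend|exact: extend_critical|exact: card_extend_lt].
Qed.

End Extend.

(** * Case (a): cuts consisting of three edges *)

Section ThreeEdgeCut.
Variable G : mgraph.
Hypotheses (wfG : wf G) (G3 : three_connected G) (Gcrit : critical_two_five G).
Variables (C : {set vt G}) (e : 'I_3 -> et G) (u v : 'I_3 -> vt G).
Hypothesis CV : C \subset vs G.
Hypotheses (eE : forall i, e i \in es G) (je : forall i, joins (e i) (u i) (v i)).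
Hypotheses (uC : forall i, u i \in C) (vC : forall i, v i \notin C).
Hypothesis crossing : forall g x y, g \in es G -> joins g x y ->
  x \in C -> y \notin C -> exists i, g = e i.

Lemma crossing_ends g x y : g \in es G -> joins g x y ->
  x \in C -> y \notin C -> exists i, [/\ g = e i, x = u i & y = v i].
Proof.
move=> gE jg xC yC; have [i gi] := crossing gE jg xC yC; exists i.
rewrite gi in jg; case: (joins_inj jg (je i)) => [[-> ->] //|[xv _]].
by rewrite xv (negPf (vC i)) in xC.
Qed.

(** If two of the three edges shared their end in [C], that end together with the outer end of the
    third edge would meet all crossing edges and separate [G], both sides having a further
    vertex. *)
Lemma three_edge_cut_ends_inj :
  (forall x, exists2 y, y \in C & y != x) ->
  (forall x, exists y, [/\ y \in vs G, y \notin C & y != x]) ->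
  injective u.
Proof.
move=> C2 D2 i j uij; apply/eqP/negPn/negP => nij.
have [k [_ _ ijk]] := ord3_third nij.
have [x xC xu] := C2 (u i); have [y [yV yC yv]] := D2 (v k).
have vV : v k \in vs G by have [] := wf_joins wfG (eE k) (je k).
apply: (@three_connected_no_vertex_cut G (u i) (v k) C x y) => //;
  try exact: (subsetP CV).
- by apply: contraNneq (vC k) => <-.
- by apply: contraNneq yC => ->.
move=> g a b gE jg au av bu bv aC; apply/negPn/negP => bC.
have [l [gl al bl]] := crossing_ends gE jg aC bC.
case/or3P: (ijk l) => /eqP hl; rewrite hl in al bl.
- by rewrite al eqxx in au.
- by rewrite al uij eqxx in au.
- by rewrite bl eqxx in bv.
Qed.

Hypotheses (uI : injective u) (vI : injective v).

Lemma three_edge_cut_piece : good_piece G (extend C (u o0) (u o1) (u o2)).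
Proof.
have attE := triple_fun u.
have eI : injective e.
  move=> i j eij; apply: uI; have := je i; rewrite eij => ji.
  case: (joins_inj ji (je j)) => [[] //|[uv _]].
  by have := uC i; rewrite uv (negPf (vC j)).
have vV i : v i \in vs G by have [] := wf_joins wfG (eE i) (je i).
apply: extend_good_piece => //.
- by move=> i; rewrite attE.
- by move=> i j; rewrite !attE => /uI.
- have : [set v o0; v o1] \subset vs G :\: C.
    by apply/subsetP => z; rewrite !inE => /orP [] /eqP ->; rewrite vC vV.
  move/subset_leq_card; apply: leq_trans; rewrite cards2.
  by rewrite (inj_eq vI).
- move=> g x y gE jg xC yC; have [i [_ xi _]] := crossing_ends gE jg xC yC.
  by exists i; rewrite attE.
- move=> s X sC [[x xS xX] [y yS yX] hX].
  (* The part of [C :\ s] on the side opposite to [b] can be left only through [s] and [e j], a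
     vertex-edge cut of [G]. *)
  have [b [j hj]] := ord3_majority (fun i => u i \in X).
  have : exists2 z, z \in C :\ s & (z \in X) != b.
    by case: (b); [exists y|exists x]; rewrite // ?xX // (negPf yX).
  case=> z zS zb; move: (zS); rewrite !inE => /andP [zs zC].
  apply: (@no_vertex_edge_cut G wfG G3 s (e j)
    [set w in C :\ s | (w \in X) != b] z (v j)) => //; try exact: (subsetP CV).
  + by rewrite !inE zs zC.
  + by apply: contraNneq (vC j) => ->.
  + by rewrite !inE (negPf (vC j)) andbF.
  move=> g p q gE ge jg ps qs; rewrite !inE ps qs /= => /andP [pC pb].
  have [qC|qC] := boolP (q \in C); last first.
    have [i [gi pi _]] := crossing_ends gE jg pC qC.
    rewrite pi hj ?eqxx // in pb.
    by apply: contraNneq ge => ij; rewrite gi ij.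
  rewrite /=; suff <- : (p \in X) = (q \in X) by [].
  apply/idP/idP; first by apply: (hX g); rewrite // !inE ?ps ?qs.
  by rewrite joinsC in jg; apply: (hX g); rewrite // !inE ?ps ?qs.
move=> f fE fs ft.
have [c [f' [X [x0 [y0 [[cV f'E f'f jf] [[x0c y0c x0X y0X] hX]]]]]]] :=
  critical_cut wfG G3 Gcrit fE.
have [x0C y0C] : x0 \in C /\ y0 \in C.
  by case: (joins_ends jf) => [] [<- <-].
have [cC|cC] := boolP (c \in C); last first.
  left; exists X, f'; split; [by exists x0|by exists y0|].
  move=> g x y; rewrite !inE negb_or => /andP [/andP [gf gf'] gE] jg xC yC.
  by rewrite (hX g x y) //; apply: contraNneq cC => <-.
have [|nb] := boolP [forall d in vs G :\: C, (d \in X) == (v o0 \in X)].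
  move=> /forall_inP hb.
  apply: (@contracted_piece_separator _ _ _ _ _ wfG c f f' X x0 y0 (v o0 \in X)) => //.
  - by move=> i; exists (e i), (v i); rewrite attE.
  - move=> g gE; have [/existsP [j /eqP jg]|nj] := boolP [exists j, e j == g].
      exists j => i ij; exists (e i), (v i); rewrite attE; split=> //.
      by rewrite -jg (inj_eq eI).
    exists o0 => i _; exists (e i), (v i); rewrite attE; split=> //.
    by apply: contra nj => h; apply/existsP; exists i.
  by move=> d dV dC; apply/eqP; apply: hb; rewrite inE dC.
(* Now [X] splits the outside, while [c] and [f] lie in [C]. The outer vertices on the side opposite
   to [b] can be left only through [e j] and [f'], a cut of two edges. *)
exfalso; have [b [j hj]] := ord3_majority (fun i => v i \in X).
have [z zD zb] : exists2 z, z \in vs G :\: C & (z \in X) != b.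
  move: nb; rewrite negb_forall => /existsP [z]; rewrite negb_imply => /andP [zD zv].
  have [h|h] := eqVneq (v o0 \in X) b; first by exists z; rewrite // -h.
  by exists (v o0); rewrite // inE vC vV.
apply: (@no_edge_cut G wfG G3 (e j) f'
  [set w in vs G :\: C | (w \in X) != b] z (u j)) => //.
- by move: zD; rewrite inE => /andP [].
- by rewrite inE zD.
- exact: (subsetP CV).
- by rewrite !inE uC.
move=> g p q gE ge gf' jg; rewrite !inE => /andP [/andP [pC pV] pb].
have [_ qV _] := wf_joins wfG gE jg; rewrite qV andbT.
have [qC|qC] /= := boolP (q \in C).
  rewrite joinsC in jg; have [i [gi _ pi]] := crossing_ends gE jg qC pC.
  rewrite pi hj ?eqxx // in pb.
  by apply: contraNneq ge => ij; rewrite gi ij.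
suff <- : (p \in X) = (q \in X) by [].
apply: (hX g) => //.
- apply: contraNneq pC => gf; rewrite gf in jg.
  by case: (joins_ends jg) => [] [h1 h2]; move: fs ft; rewrite h1 h2.
- by apply: contraNneq pC => ->.
- by apply: contraNneq qC => ->.
Qed.

End ThreeEdgeCut.

(** * Case (b): separations by a vertex and two edges *)

(** The two sides play symmetric roles, so each fact about [A] transfers to [B] by [split_sym]. Case
    (a) uses the same record after removing [c] from its side. *)
Record vertex_two_edge_split (G : mgraph) (A B : {set vt G}) (c : vt G)
    (e1 e2 : et G) (u1 u2 v1 v2 : vt G) : Prop := VertexTwoEdgeSplit {
  split_vs : forall z, (z \in vs G) = [|| z \in A, z \in B | z == c];
  split_cA : c \notin A;
  split_cB : c \notin B;
  split_disj : forall z, z \in A -> z \notin B;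
  split_e1 : e1 \in es G;
  split_e2 : e2 \in es G;
  split_j1 : joins e1 u1 v1;
  split_j2 : joins e2 u2 v2;
  split_u1 : u1 \in A;
  split_u2 : u2 \in A;
  split_v1 : v1 \in B;
  split_v2 : v2 \in B;
  split_cross : forall g x y, g \in es G -> joins g x y -> x \in A -> y \in B ->
    g = e1 \/ g = e2 }.

Section Split.
Variable G : mgraph.
Hypotheses (wfG : wf G) (G3 : three_connected G).
Implicit Types (A B X : {set vt G}).

Lemma split_sym A B c e1 e2 u1 u2 v1 v2 :
  vertex_two_edge_split A B c e1 e2 u1 u2 v1 v2 ->
  vertex_two_edge_split B A c e1 e2 v1 v2 u1 u2.
Proof.
case=> hV cA cB dAB e1E e2E j1 j2 u1A u2A v1B v2B hx; split=> //.
- by move=> z; rewrite hV orbCA.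
- by move=> z zB; apply: contraL zB; apply: dAB.
- by rewrite joinsC.
- by rewrite joinsC.
- by move=> g x y gE jg xB yA; apply: (hx g y x); rewrite // joinsC.
Qed.

Lemma split_cross_ends A B c e1 e2 u1 u2 v1 v2 :
  vertex_two_edge_split A B c e1 e2 u1 u2 v1 v2 ->
  forall g x y, g \in es G -> joins g x y -> x \in A -> y \in B ->
    (g = e1 /\ x = u1) \/ (g = e2 /\ x = u2).
Proof.
case=> hV cA cB dAB e1E e2E j1 j2 u1A u2A v1B v2B hx g x y gE jg xA yB.
have aux e u v : joins e u v -> v \in B -> g = e -> x = u.
  move=> je vB ge; rewrite ge in jg; case: (joins_inj jg je) => [[-> //]|[xv _]].
  by move: (dAB x xA); rewrite xv vB.
by case: (hx g x y gE jg xA yB) => ge; [left|right]; split=> //;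
  [apply: (aux e1 u1 v1)|apply: (aux e2 u2 v2)].
Qed.

(** This is the connectedness of [G[A]]: if no edge inside [A] crossed [X], the part of [A] not on
    the side of [u1] could be left only through [c] and [e2]. *)
Lemma split_side_connected A B c e1 e2 u1 u2 v1 v2 X x y :
  vertex_two_edge_split A B c e1 e2 u1 u2 v1 v2 ->
  x \in A -> x \in X -> y \in A -> y \notin X ->
  exists g a b, [/\ g \in es G, joins g a b, a \in A & b \in A] /\
    (a \in X) && (b \notin X).
Proof.
move=> sp; have hends := split_cross_ends sp.
case: sp => hV cA cB dAB e1E e2E j1 j2 u1A u2A v1B v2B hx xA xX yA yX.
have [/existsP [g /existsP [a /existsP [b /and5P [h1 h2 h3 h4 h5]]]]|nE] := boolP
  [exists g, exists a, exists b, [&& g \in es G, joins g a b, a \in A, b \in A &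
     (a \in X) && (b \notin X)]].
  by exists g, a, b.
have clean g a b : g \in es G -> joins g a b -> a \in A -> b \in A ->
    (a \in X) = (b \in X).
  have one a' b' : g \in es G -> joins g a' b' -> a' \in A -> b' \in A ->
      a' \in X -> b' \in X.
    move=> gE jg aA bA aX; apply: contraNT nE => bX.
    apply/existsP; exists g; apply/existsP; exists a'; apply/existsP; exists b'.
    by rewrite gE jg aA bA aX.
  by move=> gE jg aA bA; apply/idP/idP; apply: one; rewrite // joinsC.
have nc z : z \in A -> z != c by move=> zA; apply: contraNneq cA => <-.
have [z zA zX] : exists2 z, z \in A & (z \in X) != (u1 \in X).
  by case: (u1 \in X); [exists y|exists x]; rewrite // ?xX ?(negPf yX).
exfalso; apply: (@no_vertex_edge_cut G wfG G3 c e2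
  [set w in A | (w \in X) != (u1 \in X)] z v1) => //; rewrite ?hV ?zA ?v1B ?eqxx ?orbT //.
- exact: nc.
- by rewrite inE zA.
- by apply: contraNneq cB => <-.
- by rewrite inE negb_and; apply/orP; left; apply: contraL v1B; apply: dAB.
move=> g p q gE ge jg pc qc; rewrite !inE => /andP [pA pX].
have [_] := wf_joins wfG gE jg; rewrite hV (negPf qc) orbF => /orP [qA|qB] _.
  by rewrite qA -(clean g p q).
case: (hends g p q gE jg pA qB) => [] [h1 h2]; first by rewrite h2 eqxx in pX.
by rewrite h1 eqxx in ge.
Qed.

(** Quantifying over [f] in the last two hypotheses expresses that [c] has at least two edges into
    each side. *)
Lemma split_piece A B c e1 e2 u1 u2 v1 v2 :
  critical_two_five G ->
  vertex_two_edge_split A B c e1 e2 u1 u2 v1 v2 -> u1 != u2 -> v1 != v2 ->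
  (forall f, exists g d, [/\ g \in es G, g != f, joins g c d & d \in A]) ->
  (forall f, exists g d, [/\ g \in es G, g != f, joins g c d & d \in B]) ->
  good_piece G (extend (A :|: [set c]) u1 u2 c).
Proof.
move=> Gcrit sp u12 v12 cA2 cB2.
have hends := split_cross_ends sp; have hends' := split_cross_ends (split_sym sp).
have connA := fun X x y => @split_side_connected A B c e1 e2 u1 u2 v1 v2 X x y sp.
have connB := fun X x y =>
  @split_side_connected B A c e1 e2 v1 v2 u1 u2 X x y (split_sym sp).
case: (sp) => hV cA cB dAB e1E e2E j1 j2 u1A u2A v1B v2B hx.
set C := A :|: [set c].
have inC z : (z \in C) = (z \in A) || (z == c) by rewrite !inE.
have cV : c \in vs G by rewrite hV eqxx !orbT.
have AV z : z \in A -> z \in vs G by rewrite hV => ->.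
have BV z : z \in B -> z \in vs G by rewrite hV => ->; rewrite orbT.
have Ac z : z \in A -> z != c by move=> zA; apply: contraNneq cA => <-.
have Bc z : z \in B -> z != c by move=> zB; apply: contraNneq cB => <-.
have dBA z : z \in B -> z \notin A by move=> zB; apply: contraL zB; apply: dAB.
have BC z : z \in B -> z \notin C by move=> zB; rewrite inC negb_or dBA ?Bc.
have notC z : z \in vs G -> z \notin C -> z \in B.
  by rewrite hV inC negb_or => /or3P [->|//|->] /andP [].
have CV : C \subset vs G.
  by apply/subsetP => z; rewrite inC => /orP [/AV //|/eqP ->].
have nAB a b : a \in A -> b \in B -> a != b.
  by move=> aA bB; apply: contraNneq (dBA b bB) => <-.
apply: extend_good_piece => //.
- move=> i; case/or3P: (ord3P i) => /eqP ->;
  by rewrite /triple /= inC ?u1A ?u2A ?eqxx ?orbT.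
- by apply: triple_inj; rewrite // ?Ac.
- have : [set v1; v2] \subset vs G :\: C.
    by apply/subsetP => z; rewrite !in_setU !in_set1 => /orP [] /eqP ->;
      rewrite in_setD BC ?BV.
  by move/subset_leq_card; apply: leq_trans; rewrite cards2 v12.
- move=> g x y gE jg; rewrite inC => /orP [xA|/eqP ->] yC; last by exists o2.
  have [_ yV _] := wf_joins wfG gE jg.
  by case: (hends g x y gE jg xA (notC y yV yC)) => [] [_ ->]; [exists o0|exists o1].
- move=> s X; rewrite inC => sC [[x xS xX] [y yS yX] hX].
  have clean g p q : g \in es G -> joins g p q -> p \in C -> q \in C -> p != s ->
      q != s -> (p \in X) = (q \in X).
    move=> gE jg pC qC ps qs.
    apply/idP/idP; first by apply: (hX g); rewrite // in_setD1 ?ps ?qs ?pC ?qC.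
    by rewrite joinsC in jg; apply: (hX g); rewrite // in_setD1 ?ps ?qs ?pC ?qC.
  move: xS yS; rewrite !in_setD1 => /andP [xs xC] /andP [ys yC].
  case/orP: sC => [sA|/eqP sc]; last first.
    rewrite sc in xs ys; rewrite !inC (negPf xs) (negPf ys) !orbF in xC yC.
    have [g [a [b [[gE jg aA bA] /andP [aX bX]]]]] := connA X x y xC xX yC yX.
    move: bX; rewrite -(clean g a b) ?aX // ?inC ?aA ?bA // sc; exact: Ac.
  have cC : c \in C by rewrite inC eqxx orbT.
  have cs : c != s by rewrite eq_sym Ac.
  have [z zC /andP [zs zX]] : exists2 z, z \in C & (z != s) && ((z \in X) != (c \in X)).
    by case: (c \in X); [exists y|exists x]; rewrite // ?xX ?(negPf yX) ?xs ?ys.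
  have zA : z \in A.
    by move: zC; rewrite inC => /orP [//|/eqP zc]; rewrite zc eqxx in zX.
  (* The part of [A] cut off from [c] by [s]. It can be left only through [s], [e1] and [e2], so it
     contains both [u1] and [u2]: otherwise [s] with one of the two edges would separate it from
     [c]. *)
  pose P := [set w in A | (w != s) && ((w \in X) != (c \in X))].
  have inP (u u' : vt G) (e e' : et G) : e \in es G ->
      (forall g x y, g \in es G -> joins g x y -> x \in A -> y \in B ->
         (g = e /\ x = u) \/ (g = e' /\ x = u')) -> u' \in P.
    move=> eE hh; apply/negPn/negP => uP.
    apply: (@no_vertex_edge_cut G wfG G3 s e P z c) => //; try exact: AV.
    - by rewrite inE zA zs.
    - by rewrite inE (negPf cA).
    move=> g p q gE ge jg ps qs pP; move: (pP); rewrite inE => /and3P [pA _ pX].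
    have [_ qV _] := wf_joins wfG gE jg.
    have [qC|qC] := boolP (q \in C).
      move: pX; rewrite (clean g p q) // ?inC ?pA // => qX; rewrite inE qs qX.
      by move: qC; rewrite inC => /orP [-> //|/eqP qc]; rewrite qc eqxx in qX.
    case: (hh g p q gE jg pA (notC q qV qC)) => [] [h1 h2].
      by rewrite h1 eqxx in ge.
    by rewrite h2 (negPf uP) in pP.
  have u2P : u2 \in P by apply: (inP u1 u2 e1 e2).
  have u1P : u1 \in P.
    apply: (inP u2 u1 e2 e1) => // g p q gE jg pA qB.
    by case: (hends g p q gE jg pA qB); [right|left].
  (* Since [e1] and [e2] both start in [P], any other vertex of [A] on the side of [c] would be
     separated from [B] by [c] and [s]. *)
  have [/existsP [w /and3P [wA ws wX]]|nQ] :=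
      boolP [exists w, [&& w \in A, w != s & (w \in X) == (c \in X)]].
    apply: (@three_connected_no_vertex_cut G c s
      [set w in A | (w \in X) == (c \in X)] w v1) => //.
    - exact: AV.
    - exact: AV.
    - exact: Ac.
    - by rewrite inE wA.
    - exact: BV.
    - exact: Bc.
    - by rewrite eq_sym; apply: nAB.
    - by rewrite inE (negPf (dBA _ v1B)).
    move=> g p q gE jg pc ps qc qs; rewrite inE => /andP [pA pX].
    have [_ qV _] := wf_joins wfG gE jg.
    have [qC|qC] := boolP (q \in C).
      move: pX; rewrite (clean g p q) // ?inC ?pA // inE => ->.
      by move: qC; rewrite inC (negPf qc) orbF => ->.
    case: (hends g p q gE jg pA (notC q qV qC)) => [] [_ h2]; rewrite h2 in pX.
      by exfalso; move: u1P; rewrite inE => /and3P [_ _ /negP []].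
    by exfalso; move: u2P; rewrite inE => /and3P [_ _ /negP []].
  (* All of [A] except [s] is in [P], so the edges from [c] into [A] all end at [s]; two of them
     would be parallel. *)
  have only g d : g \in es G -> joins g c d -> d \in A -> d = s.
    move=> gE jg dA; apply/eqP; apply: contraNT nQ => ds; apply/existsP; exists d.
    by rewrite dA ds -(clean g c d) ?eqxx // inC dA.
  have [g1 [d1 [g1E _ jg1 d1A]]] := cA2 e1.
  have [g2 [d2 [g2E g12 jg2 d2A]]] := cA2 g1.
  have h1 := only _ _ g1E jg1 d1A; have h2 := only _ _ g2E jg2 d2A; subst d1 d2.
  by move: g12; rewrite (critical_simple wfG G3 Gcrit g1E g2E jg1 jg2) eqxx.
move=> f fE fs ft.
have [c' [f' [X [x0 [y0 [[c'V f'E f'f jf] [[x0c y0c x0X y0X] hX]]]]]]] :=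
  critical_cut wfG G3 Gcrit fE.
have [x0C y0C] : x0 \in C /\ y0 \in C.
  by case: (joins_ends jf) => [] [<- <-].
have [c'B|c'B] := boolP (c' \in B).
  left; exists X, f'; split; [by exists x0|by exists y0|].
  move=> g x y; rewrite in_setD in_set2 negb_or => /andP [/andP [gf gf'] gE] jg xC yC.
  rewrite (hX g x y) //; [apply: contraNneq (BC _ c'B) => <- //|].
  by apply: contraNneq (BC _ c'B) => <-.
have c'C : c' \in C by apply: contraNT c'B; apply: notC.
have Bc' z : z \in B -> z != c' by move=> zB; apply: contraNneq c'B => <-.
have fB g x y : joins g x y -> x \in B -> g != f.
  move=> jg xB; apply: contraNneq (BC _ xB) => gf; rewrite gf in jg.
  by case: (joins_ends jg) => [] [h1 h2]; move: fs ft; rewrite h1 h2.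
have [|nb] := boolP [forall d in B, (d \in X) == (v1 \in X)].
  move=> /forall_inP hb.
  apply: (@contracted_piece_separator _ _ _ _ _ wfG c' f f' X x0 y0 (v1 \in X)) => //.
  - move=> i; case/or3P: (ord3P i) => /eqP ->.
    + by exists e1, v1; split=> //; apply: BC.
    + by exists e2, v2; split=> //; apply: BC.
    by have [g [d [gE _ jg dB]]] := cB2 e1; exists g, d; split=> //; apply: BC.
  - have e12 : e1 != e2.
      apply: contraNneq u12 => e12; have j1' := j1; rewrite e12 in j1'.
      case: (joins_inj j1' j2) => [[-> //]|[uv _]].
      by move: u1A; rewrite uv (negPf (dBA _ v2B)).
    (* Removing [e1] affects only the attachment at [u1], and removing any other edge at most the
       one at [u2]; the attachment at [c] always survives because [c] has two edges into [B]. *)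
    move=> g gE; exists (if g == e1 then o0 else o1) => i ij.
    have hc : exists g' d, [/\ g' \in es G, g' != g, joins g' c d & d \notin C].
      by have [g' [d [gE' gg jg dB]]] := cB2 g; exists g', d; split=> //; apply: BC.
    move: ij; case: ifP => [/eqP ->|/negbT ge1];
      case/or3P: (ord3P i) => /eqP -> // _; try exact: hc.
    + by exists e2, v2; split; rewrite // 1?eq_sym //; apply: BC.
    + have [g' [d [gE' _ jg dB]]] := cB2 e1; exists g', d; split=> //; last exact: BC.
      apply: contraTneq jg => ->; apply/negP => jc.
      case: (joins_inj j1 jc) => [] [h1 h2].
        by move: cA; rewrite -h1 u1A.
      by move: cB; rewrite -h2 v1B.
    by exists e1, v1; split; rewrite // 1?eq_sym //; apply: BC.
  by move=> d dV dC; apply/eqP; apply: hb; apply: notC.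
(* As [G[B]] is connected and [X] splits [B], some edge inside [B] crosses [X]. It is not [f], which
   lies in [C], and it avoids [c'], so it is [f']. *)
have [g0 [a [b [[g0E jg0 aB bB] /andP [aX bX]]]]] :
    exists g a b, [/\ g \in es G, joins g a b, a \in B & b \in B] /\
      (a \in X) && (b \notin X).
  move: nb; rewrite negb_forall => /existsP [d]; rewrite negb_imply => /andP [dB].
  case dX: (d \in X); case vX: (v1 \in X) => // _.
    by apply: (connB X d v1); rewrite ?vX.
  by apply: (connB X v1 d); rewrite ?dX.
have gf' : g0 = f'.
  apply/eqP; apply: contraNT bX => gf'; rewrite -(hX g0 a b) //; try exact: Bc'.
  exact: (fB _ _ _ jg0).
rewrite {g0 g0E}gf' in jg0.
have f'B g x y : joins g x y -> x \notin B -> g != f'.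
  move=> jg; apply: contraNneq => gf; rewrite gf in jg.
  by case: (joins_inj jg jg0) => [] [-> _].
have [cc'|cc'] := eqVneq c' c.
  subst c'.
  have x0A : x0 \in A by move: x0C; rewrite inC (negPf x0c) orbF.
  have y0A : y0 \in A by move: y0C; rewrite inC (negPf y0c) orbF.
  have diff : (u1 \in X) != (u2 \in X).
    apply/negP => /eqP uX.
    have [z zA zX] : exists2 z, z \in A & (z \in X) != (u1 \in X).
      by case: (u1 \in X); [exists y0|exists x0]; rewrite // ?x0X ?(negPf y0X).
    apply: (@no_vertex_edge_cut G wfG G3 c f
      [set w in A | (w \in X) != (u1 \in X)] z v1) => //.
    - exact: AV.
    - exact: Ac.
    - by rewrite inE zA.
    - exact: BV.
    - exact: Bc.
    - by rewrite inE (negPf (dBA _ v1B)).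
    move=> g p q gE ge jg pc qc; rewrite !inE => /andP [pA pX].
    have [_] := wf_joins wfG gE jg; rewrite hV (negPf qc) orbF => /orP [qA|qB] _.
      by rewrite qA -(hX g p q) //; apply: (f'B _ _ _ jg); apply: dAB.
    by case: (hends g p q gE jg pA qB) => [] [_ h]; rewrite h ?uX eqxx in pX.
  (* the parts of [A] on the two sides of [X] are joined by [f] alone in [G - c],
     and the new vertex is joined to both *)
  right; exists c, X, x0, y0, (u2 \in X), (inr o0).
  do !split=> //; first by rewrite inr_es.
  - move=> g x y gE gf _ jg xC yC xc yc; apply: (hX g) => //.
    apply: (f'B _ _ _ jg); apply: dAB.
    by move: xC; rewrite inC (negPf xc) orbF.
  move=> i; case/or3P: (ord3P i) => /eqP -> //.
  by rewrite /triple /= eqxx.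
have c'A : c' \in A by move: c'C; rewrite inC (negPf cc') orbF.
have cc : c != c' by rewrite eq_sym.
have clean g p q : g \in es G -> g != f' -> joins g p q -> p \in B -> q != c' ->
    (p \in X) = (q \in X).
  move=> gE gf' jg pB qc; apply: (hX g) => //; last exact: Bc'.
  exact: (fB _ _ _ jg).
have [z zB zX] : exists2 z, z \in B & (z \in X) != (c \in X).
  by case: (c \in X); [exists b|exists a]; rewrite // ?aX ?(negPf bX).
have [w wB wX] : exists2 w, w \in B & (w \in X) = (c \in X).
  by case: (c \in X); [exists a|exists b]; rewrite // ?aX ?(negPf bX).
(* Now [c'] is in [A], so [c] itself has a side. The part of [B] opposite to [c] can be left only
   through [f'], [e1] and [e2]; it contains [v1] and [v2], since otherwise [f'] and one of [e1],
   [e2] would form a cut of two edges. *)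
pose P := [set w in B | (w \in X) != (c \in X)].
have inP (v v' : vt G) (e e' : et G) : e \in es G ->
    (forall g x y, g \in es G -> joins g x y -> x \in B -> y \in A ->
       (g = e /\ x = v) \/ (g = e' /\ x = v')) -> v' \in P.
  move=> eE hh; apply/negPn/negP => vP.
  apply: (@no_edge_cut G wfG G3 f' e P z c) => //.
  - exact: BV.
  - by rewrite inE zB.
  - by rewrite inE (negPf cB).
  move=> g p q gE gf' ge jg pP; move: (pP); rewrite inE => /andP [pB pX].
  have [_] := wf_joins wfG gE jg; rewrite hV => /or3P [qA|qB|/eqP qc] _.
  - case: (hh g p q gE jg pB qA) => [] [h1 h2]; first by rewrite h1 eqxx in ge.
    by rewrite h2 (negPf vP) in pP.
  - by rewrite inE qB -(clean g p q) //; apply: Bc'.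
  - by move: pX; rewrite (clean g p q) // qc ?eqxx.
have v2P : v2 \in P by apply: (inP v1 v2 e1 e2).
have v1P : v1 \in P.
  apply: (inP v2 v1 e2 e1) => // g p q gE jg pA qB.
  by case: (hends' g p q gE jg pA qB); [right|left].
(* The rest of [B] meets neither [e1] nor [e2], so [c] and [f'] cut it off. *)
exfalso; apply: (@no_vertex_edge_cut G wfG G3 c f'
  [set w in B | (w \in X) == (c \in X)] w v1) => //.
- exact: BV.
- exact: Bc.
- by rewrite inE wB wX eqxx.
- exact: BV.
- exact: Bc.
- by move: v1P; rewrite !inE => /andP [_ /negPf ->]; rewrite andbF.
move=> g p q gE gf' jg pc qc; rewrite !inE => /andP [pB pX].
have [_] := wf_joins wfG gE jg; rewrite hV (negPf qc) orbF => /orP [qA|qB] _.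
  case: (hends' g p q gE jg pB qA) => [] [_ h2]; rewrite h2 in pX.
    by exfalso; move: v1P; rewrite inE => /andP [_ /negP []].
  by exfalso; move: v2P; rewrite inE => /andP [_ /negP []].
by rewrite qB -(clean g p q) //; apply: Bc'.
Qed.

End Split.

(** * From separators to separations *)

Section Components.
Variable G : mgraph.
Hypotheses (wfG : wf G) (G3 : three_connected G).
Implicit Types (A B C D S : {set vt G}) (F : {set et G}).

Lemma two_components_cut S F C1 C2 : two_components S F C1 C2 ->
  [/\ forall z, (z \in S) = (z \in C1) || (z \in C2),
      forall z, z \in C1 -> z \notin C2,
      exists x, x \in C1, exists y, y \in C2
    & forall e x y, e \in F -> joins e x y -> x \in C1 -> y \in C2 -> False].
Proof.
case=> [[x xS C1E] [y yS C2E] nC SC].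
have sym := sym_connect_sym (@adjC G S F).
have disj z : z \in C1 -> z \notin C2.
  rewrite C1E C2E !inE => /andP [zS xz]; rewrite zS /=.
  apply: contra nC => yz; rewrite C1E C2E; apply/eqP/setP => w; rewrite !inE.
  congr (_ && _); apply: (same_connect sym).
  by apply: connect_trans xz _; rewrite sym.
split=> //.
- move=> z; apply/idP/idP; first by move/(subsetP SC); rewrite inE.
  by rewrite C1E C2E !inE; case: (z \in S).
- by exists x; rewrite C1E inE xS connect0.
- by exists y; rewrite C2E inE yS connect0.
move=> e a b eF je aC bC; suff /disj : b \in C1 by rewrite bC.
move: aC bC; rewrite C1E C2E !inE => /andP [aS xa] /andP [bS _]; rewrite bS /=.
by apply: connect_trans xa _; apply/connect1/adjP; exists e.
Qed.

Lemma two_components_sym S F C1 C2 :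
  two_components S F C1 C2 -> two_components S F C2 C1.
Proof. by case=> h1 h2 h3 h4; split; rewrite // 1?eq_sym // setUC. Qed.

(** Both edges really cross between the sides: if one did not, [c] and the other edge would be a
    vertex-edge cut. *)
Lemma cut_split A B c e1 e2 :
  c \in vs G -> e1 \in es G -> e2 \in es G ->
  (forall z, (z \in vs G) = [|| z \in A, z \in B | z == c]) ->
  c \notin A -> c \notin B -> (forall z, z \in A -> z \notin B) ->
  (exists x, x \in A) -> (exists y, y \in B) ->
  (forall g x y, g \in es G -> g != e1 -> g != e2 -> joins g x y ->
     x \in A -> y \in B -> False) ->
  exists u1 u2 v1 v2, vertex_two_edge_split A B c e1 e2 u1 u2 v1 v2.
Proof.
move=> cV e1E e2E hV cA cB dAB [x xA] [y yB] hx.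
have cross e e' : e' \in es G -> (forall g p q, g \in es G -> g != e -> g != e' ->
    joins g p q -> p \in A -> q \in B -> False) ->
    exists u v, [/\ joins e u v, u \in A & v \in B].
  move=> e'E hx'.
  have [/existsP [u /existsP [v /and3P [h1 h2 h3]]]|nE] :=
    boolP [exists u, exists v, [&& joins e u v, u \in A & v \in B]].
    by exists u, v.
  exfalso; apply: (@no_vertex_edge_cut G wfG G3 c e' A x y) => //.
  - by rewrite hV xA.
  - by apply: contraNneq cA => <-.
  - by rewrite hV yB orbT.
  - by apply: contraNneq cB => <-.
  - by apply: contraL yB; apply: dAB.
  move=> g p q gE ge' jg pc qc pA.
  have [_] := wf_joins wfG gE jg; rewrite hV (negPf qc) orbF => /orP [//|qB] _.
  have [ge|ge] := eqVneq g e; last by case: (hx' g p q).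
  case/negP: nE; apply/existsP; exists p; apply/existsP; exists q.
  by rewrite -ge jg pA qB.
have [u1 [v1 [j1 u1A v1B]]] := cross e1 e2 e2E hx.
have [u2 [v2 [j2 u2A v2B]]] : exists u v, [/\ joins e2 u v, u \in A & v \in B].
  by apply: (cross e2 e1) => // g p q gE h1 h2; apply: hx.
exists u1, u2, v1, v2; split=> //.
move=> g p q gE jg pA qB.
have [->|n1] := eqVneq g e1; first by left.
have [->|n2] := eqVneq g e2; first by right.
by case: (hx g p q).
Qed.

(** Connectedness of [G[A]] comes from [split_side_connected], whose crossing edge lies inside [A]
    and therefore differs from [e1] and [e2]. Together with the symmetric fact for [B] it yields the
    two components claimed in case (b). *)
Lemma split_component A B c e1 e2 u1 u2 v1 v2 :
  vertex_two_edge_split A B c e1 e2 u1 u2 v1 v2 ->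
  is_component (vs G :\ c) (es G :\: [set e1; e2]) A.
Proof.
move=> sp; case: (sp) => hV cA cB dAB e1E e2E j1 j2 u1A u2A v1B v2B hx.
set S := vs G :\ c; set F := es G :\: [set e1; e2].
have AS z : z \in A -> z \in S.
  by move=> zA; rewrite !inE hV zA andbT; apply: contraNneq cA => <-.
exists u1; first exact: AS.
apply/setP => y; rewrite inE; apply/idP/andP => [yA|[yS cy]].
  split; first exact: AS.
  apply/negPn/negP => ny.
  have [||g [a [b [[gE jg aA bA] /andP []]]]] := @split_side_connected G wfG G3
    A B c e1 e2 u1 u2 v1 v2 [set z | connect (adj S F) u1 z] u1 y sp u1A _ yA.
  - by rewrite inE connect0.
  - by rewrite inE.
  rewrite !inE => ca /negP []; apply: connect_trans ca _; apply/connect1/adjP.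
  exists g; split=> //; try exact: AS.
  rewrite !inE gE andbT negb_or; apply/andP; split; apply/eqP => ge; rewrite ge in jg.
    by case: (joins_inj jg j1) => [] [h1 h2]; subst; [move: (dAB v1 bA)|move: (dAB v1 aA)]; rewrite v1B.
  by case: (joins_inj jg j2) => [] [h1 h2]; subst; [move: (dAB v2 bA)|move: (dAB v2 aA)]; rewrite v2B.
have clA : closed (adj S F) (mem A).
  apply: intro_closed; first by apply: sym_connect_sym; apply: adjC.
  move=> p q /adjP [g [gF jg pS qS]] /= pA.
  move: qS; rewrite !inE hV => /andP [/negPf ->]; rewrite orbF => /orP [//|qB].
  move: gF; rewrite !inE negb_or => /andP [/andP [/negP n1 /negP n2] gE].
  by case: (hx g p q gE jg pA qB) => /eqP.
by have := closed_connect clA cy; rewrite /= u1A => <-.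
Qed.

(** If both edges end at [u] in [A], then [A] is just [u], as otherwise [c] and [u] separate. An
    edge from [u] to [c] exists because [e1] and [e2] alone are no cut, and it is unique because
    there are no parallel edges. So [u] has degree 3 and witnesses degeneracy. *)
Lemma nondegenerate_ends A B c e1 e2 u1 u2 v1 v2 :
  critical_two_five G -> c \in vs G -> ~ degenerate c e1 e2 ->
  vertex_two_edge_split A B c e1 e2 u1 u2 v1 v2 -> u1 != u2.
Proof.
move=> Gcrit cV ndeg sp; have hends := split_cross_ends sp.
case: sp => hV cA cB dAB e1E e2E j1 j2 u1A u2A v1B v2B hx.
apply/eqP => u12; subst u2; case: ndeg; set u := u1 in j1 j2 u1A u2A hends *.
have AV z : z \in A -> z \in vs G by rewrite hV => ->.
have BV z : z \in B -> z \in vs G by rewrite hV => ->; rewrite orbT.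
have Ac z : z \in A -> z != c by move=> zA; apply: contraNneq cA => <-.
have Bc z : z \in B -> z != c by move=> zB; apply: contraNneq cB => <-.
have dBA z : z \in B -> z \notin A by move=> zB; apply: contraL zB; apply: dAB.
have A1 z : z \in A -> z = u.
  move=> zA; apply/eqP/negPn/negP => zu.
  apply: (@three_connected_no_vertex_cut G c u A z v1) => //;
    try solve [exact: AV | exact: BV | exact: Ac | exact: Bc | exact: dBA].
    by apply: contraNneq (dBA _ v1B) => ->.
  move=> g p q gE jg pc pu qc qu pA.
  have [_] := wf_joins wfG gE jg; rewrite hV (negPf qc) orbF => /orP [//|qB] _.
  by case: (hends g p q gE jg pA qB) => [] [_ h]; rewrite h eqxx in pu.
have [e0 e0E j0] : exists2 e0, e0 \in es G & joins e0 u c.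
  have [/existsP [e0 /andP [h1 h2]]|nE] := boolP [exists e0, (e0 \in es G) && joins e0 u c].
    by exists e0.
  exfalso; apply: (@no_edge_cut G wfG G3 e1 e2 A u v1) => //;
    try solve [exact: AV | exact: BV | exact: dBA].
  move=> g p q gE g1 g2 jg pA.
  have [_] := wf_joins wfG gE jg; rewrite hV => /or3P [//|qB|/eqP qc] _.
    by case: (hx g p q gE jg pA qB) => h; rewrite h eqxx in g1 g2.
  case/negP: nE; apply/existsP; exists g; rewrite gE -qc -(A1 p) //.
have inc : [set e in es G | incident e u] = [set e0; e1; e2].
  apply/setP => g; rewrite !inE; apply/andP/idP.
    case=> gE /joins_incident [y jg].
    have [_] := wf_joins wfG gE jg; rewrite hV => /or3P [yA|yB|/eqP yc] ny.
    - by rewrite (A1 y yA) eqxx in ny.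
    - by case: (hx g u y gE jg u1A yB) => ->; rewrite eqxx ?orbT.
    - by rewrite yc in jg; rewrite (critical_simple wfG G3 Gcrit gE e0E jg j0) eqxx.
  by case/orP => [/orP []|] /eqP ->; split=> //;
    [exact: incident_joins j0|exact: incident_joins j1|exact: incident_joins j2].
have e0n e v : joins e u v -> v \in B -> e0 != e.
  move=> je vB; apply: contraNneq (Bc _ vB) => ee; rewrite -ee in je.
  by case: (joins_inj je j0) => [] [h1 h2]; rewrite h2 // -h1.
have e12 : e1 != e2.
  apply/eqP => e12; apply: (@no_vertex_edge_cut G wfG G3 c e1 A u v1) => //;
    try solve [exact: AV | exact: BV | exact: Ac | exact: Bc | exact: dBA].
  move=> g p q gE ge jg pc qc pA.
  have [_] := wf_joins wfG gE jg; rewrite hV (negPf qc) orbF => /orP [//|qB] _.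
  by case: (hx g p q gE jg pA qB) => h; rewrite h ?e12 eqxx in ge.
exists u, e0; split=> //; first exact: AV.
by rewrite inc -setUA cardsU1 cards2 e12 !inE negb_or (e0n e1 v1) // (e0n e2 v2).
Qed.

(** If [f] were the only edge from [c] into [A], then [f], [e1], [e2] would cut off [A], which is
    the situation of case (a). With no edge from [c] into [A], already [e1] and [e2] would do so. *)
Lemma split_two_edges_to_side A B c e1 e2 u1 u2 v1 v2 :
  vertex_two_edge_split A B c e1 e2 u1 u2 v1 v2 ->
  ~ (exists2 e0 : et G, (e0 \in es G) && incident e0 c &
        ~ connected_sub (vs G) (es G :\: [set e0; e1; e2])) ->
  forall f, exists g d, [/\ g \in es G, g != f, joins g c d & d \in A].
Proof.
case=> hV cA cB dAB e1E e2E j1 j2 u1A u2A v1B v2B hx nsep f.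
have AV z : z \in A -> z \in vs G by rewrite hV => ->.
have BV z : z \in B -> z \in vs G by rewrite hV => ->; rewrite orbT.
have dBA z : z \in B -> z \notin A by move=> zB; apply: contraL zB; apply: dAB.
have [/existsP [g /existsP [d /and4P [h1 h2 h3 h4]]]|nE] := boolP
    [exists g, exists d, [&& g \in es G, g != f, joins g c d & d \in A]].
  by exists g, d.
have only g d : g \in es G -> joins g c d -> d \in A -> g = f.
  move=> gE jg dA; apply/eqP; apply: contraNT nE => gf.
  by apply/existsP; exists g; apply/existsP; exists d; rewrite gE gf jg.
have step g p q : g \in es G -> g != f -> g != e1 -> g != e2 -> joins g p q ->
    p \in A -> q \in A.
  move=> gE gf g1 g2 jg pA; have [_] := wf_joins wfG gE jg.
  rewrite hV => /or3P [//|qB|/eqP qc] _.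
    by case: (hx g p q gE jg pA qB) => h; rewrite h eqxx in g1 g2.
  by move: gf; rewrite (only g p gE _ pA) ?eqxx // joinsC -qc.
exfalso; have [/andP [fE fc]|nf] := boolP ((f \in es G) && incident f c).
  apply: nsep; exists f; first by rewrite fE.
  apply: (@separates_disconnected _ _ _ A); split.
  - by exists u1; rewrite ?AV.
  - by exists v1; rewrite ?BV ?dBA.
  move=> g p q; rewrite !inE !negb_or => /andP [/andP [/andP [gf g1] g2] gE] jg _ _.
  exact: (step g).
apply: (@no_edge_cut G wfG G3 e1 e2 A u1 v1) => //;
    try solve [exact: AV | exact: BV | exact: dBA].
move=> g p q gE g1 g2 jg pA.
have [gf|gf] := eqVneq g f; last exact: (step g p q).
have [_] := wf_joins wfG gE jg; rewrite hV => /or3P [//|qB|/eqP qc] _.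
  by case: (hx g p q gE jg pA qB) => h; rewrite h eqxx in g1 g2.
by case/negP: nf; rewrite -gf gE -qc; apply: (@incident_joins _ _ _ p); rewrite joinsC.
Qed.

(** Non-degeneracy speaks of the separator with vertex [c], so it is exploited through the
    separation by [c], [e1], [e2]. It provides two vertices on each side, which forces the three
    edges of the cut to have distinct ends. *)
Lemma three_edge_cut_pieces C D c e0 e1 e2 :
  critical_two_five G -> v2e_separator c e1 e2 -> ~ degenerate c e1 e2 ->
  e0 \in es G -> incident e0 c -> c \in D ->
  two_components (vs G) (es G :\: [set e0; e1; e2]) C D ->
  good_piece G (buildA C e0 e1 e2) /\ good_piece G (buildA D e0 e1 e2).
Proof.
move=> Gcrit [cV e1E e2E nsep] ndeg e0E e0c cD /two_components_cut.
case=> hV dCD [x xC] [y yD] hx.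
have CV z : z \in C -> z \in vs G by rewrite hV => ->.
have DV z : z \in D -> z \in vs G by rewrite hV => ->; rewrite orbT.
have dDC z : z \in D -> z \notin C by move=> zB; apply: contraL zB; apply: dCD.
pose e := triple e0 e1 e2.
have eE i : e i \in es G by rewrite /e; case/or3P: (ord3P i) => /eqP ->.
have crossing g p q : g \in es G -> joins g p q -> p \in C -> q \in D ->
    exists i, g = e i.
  move=> gE jg pC qD; have [/or3P [] /eqP ->|] := boolP [|| g == e0, g == e1 | g == e2].
  - by exists o0.
  - by exists o1.
  - by exists o2.
  rewrite !negb_or => /and3P [n0 n1 n2]; case: (hx g p q) => //.
  by rewrite !inE !negb_or n0 n1 n2.
have crosses i : exists p q, [/\ joins (e i) p q, p \in C & q \in D].
  have [/existsP [p /existsP [q /and3P [h1 h2 h3]]]|nE] :=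
    boolP [exists p, exists q, [&& joins (e i) p q, p \in C & q \in D]].
    by exists p, q.
  have [j ij] : exists j, i != j.
    by case/or3P: (ord3P i) => /eqP ->; [exists o1|exists o0|exists o0].
  have [k [_ _ ijk]] := ord3_third ij.
  exfalso; apply: (@no_edge_cut G wfG G3 (e j) (e k) C x y) => //;
    try solve [exact: CV | exact: DV | exact: dDC].
  move=> g p q gE gj gk jg pC; have [_] := wf_joins wfG gE jg.
  rewrite hV => /orP [//|qD] _; have [l gl] := crossing g p q gE jg pC qD.
  case/or3P: (ijk l) => /eqP hl; rewrite gl hl ?eqxx // in gj gk jg *.
  by case/negP: nE; apply/existsP; exists p; apply/existsP; exists q; rewrite jg pC.
pose u i := endin C (e i); pose v i := endin D (e i).
have uv i : [/\ joins (e i) (u i) (v i), u i \in C & v i \in D].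
  have [p [q [jpq pC qD]]] := crosses i.
  rewrite /u /v (endinE jpq pC (dDC q qD)).
  by rewrite joinsC in jpq; rewrite (endinE jpq qD (dCD p pC)) joinsC.
have je i : joins (e i) (u i) (v i) by case: (uv i).
have uC i : u i \in C by case: (uv i).
have vD i : v i \in D by case: (uv i).
have v0c : v o0 = c.
  have [w jw] := joins_incident e0c; have := je o0; rewrite /e /triple /= => j0.
  case: (joins_inj j0 jw) => [] [h1 h2] //.
  by move: (dDC c cD); rewrite -h1 uC.
(* removing [c] turns the three-edge cut into the separation (c, e1, e2) *)
have [u1 [u2 [v1 [v2 sp]]]] :
    exists u1 u2 v1 v2, vertex_two_edge_split C (D :\ c) c e1 e2 u1 u2 v1 v2.
  apply: cut_split => //.
  - move=> z; rewrite hV !inE; case: (z =P c) => [->|_] /=; last by rewrite orbF.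
    by rewrite cD orbT.
  - exact: dDC.
  - by rewrite !inE eqxx.
  - by move=> z zC; rewrite !inE negb_and (dCD z zC) orbT.
  - by exists x.
  (* If [D] were only [c], all three edges would end at [c]; the disconnection of [G - e1 - e2 - c]
     would then be one of [G - c]. *)
  - have [/existsP [z zD]|nD] := boolP [exists z, z \in D :\ c]; first by exists z.
    have D1 z : z \in D -> z = c.
      move=> zD; apply/eqP/negPn/negP => zc; case/negP: nD; apply/existsP.
      by exists z; rewrite !inE zc.
    have [X [[a aS aX] [b bS bX] hX]] := disconnected_separates nsep.
    move: aS bS; rewrite !inE => /andP [ac aV] /andP [bc bV].
    exfalso; apply: (@three_connected_no_vertex_cut G c c X a b) => //.
    move=> g p q gE jg pc _ qc _; have [pV qV _] := wf_joins wfG gE jg.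
    apply: (hX g) => //; rewrite !inE ?pc ?qc // gE andbT negb_or.
    have ne i : g != e i.
      apply/eqP => ge; rewrite ge in jg.
      by case: (joins_inj jg (je i)) => [] [h1 h2]; move: pc qc;
        rewrite h1 h2 (D1 (v i)) ?eqxx.
    by rewrite (ne o1) (ne o2).
  move=> g p q gE g1 g2 jg pC; rewrite !inE => /andP [qc qD].
  have [i gi] := crossing g p q gE jg pC qD.
  case/or3P: (ord3P i) => /eqP hi; rewrite gi hi ?eqxx // in g1 g2 jg.
  case: (joins_inj jg (je o0)) => [] [h1 h2].
    by rewrite h2 v0c eqxx in qc.
  by move: pC; rewrite h1 (negPf (dDC _ (vD o0))).
have u12 := nondegenerate_ends Gcrit cV ndeg sp.
have v12 := nondegenerate_ends Gcrit cV ndeg (split_sym sp).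
have C2 z : exists2 w, w \in C & w != z.
  have [uz|uz] := eqVneq u1 z; last by exists u1; rewrite // (split_u1 sp).
  by exists u2; rewrite ?(split_u2 sp) // -uz eq_sym.
have D2 z : exists2 w, w \in D & w != z.
  have inD w : w \in D :\ c -> w \in D by rewrite !inE => /andP [].
  have [vz|vz] := eqVneq v1 z; last by exists v1; rewrite // inD // (split_v1 sp).
  by exists v2; rewrite ?inD ?(split_v2 sp) // -vz eq_sym.
have subC : C \subset vs G by apply/subsetP.
have subD : D \subset vs G by apply/subsetP.
have je' i : joins (e i) (v i) (u i) by rewrite joinsC.
have vC i : v i \notin C by apply: dDC.
have uD i : u i \notin D by apply: dCD.
have notC z : z \in vs G -> z \notin C -> z \in D by rewrite hV => /orP [->|].
have notD z : z \in vs G -> z \notin D -> z \in C by rewrite hV => /orP [|->].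
have crC g p q : g \in es G -> joins g p q -> p \in C -> q \notin C ->
    exists i, g = e i.
  move=> gE jg pC qC; have [_ qV _] := wf_joins wfG gE jg.
  by apply: (crossing g p q) => //; apply: notC.
have crD g p q : g \in es G -> joins g p q -> p \in D -> q \notin D ->
    exists i, g = e i.
  move=> gE jg pC qC; have [_ qV _] := wf_joins wfG gE jg.
  by apply: (crossing g q p); rewrite // 1?joinsC //; apply: notD.
have uI : injective u.
  apply: (@three_edge_cut_ends_inj G wfG G3 C e u v) => // z.
  by have [w wD wz] := D2 z; exists w; rewrite DV ?dDC.
have vI : injective v.
  apply: (@three_edge_cut_ends_inj G wfG G3 D e v u) => // z.
  by have [w wC wz] := C2 z; exists w; rewrite CV ?dCD.
split; first exact: (@three_edge_cut_piece G wfG G3 Gcrit C e u v).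
exact: (@three_edge_cut_piece G wfG G3 Gcrit D e v u).
Qed.

End Components.

Theorem theorem7 (G : mgraph) (c : vt G) (e1 e2 : et G) :
  wf G -> three_connected G -> v2e_separator c e1 e2 -> ~ degenerate c e1 e2 ->
  critical_two_five G ->
  (* case (a) *)
  (forall e0 : et G, e0 \in es G -> incident e0 c ->
     ~ connected_sub (vs G) (es G :\: [set e0; e1; e2]) ->
     forall C1 C2 : {set vt G},
       two_components (vs G) (es G :\: [set e0; e1; e2]) C1 C2 ->
       good_piece G (buildA C1 e0 e1 e2) /\ good_piece G (buildA C2 e0 e1 e2))
  /\
  (* case (b) *)
  (~ (exists2 e0 : et G, (e0 \in es G) && incident e0 c &
        ~ connected_sub (vs G) (es G :\: [set e0; e1; e2])) ->
     (exists C1 C2 : {set vt G},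
        two_components (vs G :\ c) (es G :\: [set e1; e2]) C1 C2) /\
     forall C1 C2 : {set vt G},
       two_components (vs G :\ c) (es G :\: [set e1; e2]) C1 C2 ->
       good_piece G (buildB C1 c e1 e2) /\ good_piece G (buildB C2 c e1 e2)).
Proof.
move=> wfG G3 sep ndeg Gcrit; have [cV e1E e2E nsep] := sep; split.
  move=> e0 e0E e0c _ C1 C2 tc; have [hV _ _ _ _] := two_components_cut tc.
  have /orP [cC|cC] : (c \in C1) || (c \in C2) by rewrite -hV.
    have [] := three_edge_cut_pieces wfG G3 Gcrit sep ndeg e0E e0c cC
      (two_components_sym tc).
    by split.
  exact: (three_edge_cut_pieces wfG G3 Gcrit sep ndeg e0E e0c cC tc).
move=> no_e0; split.
  have [X [[a aS aX] [b bS bX] hX]] := disconnected_separates nsep.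
  (* Any cut [X] will do: both of its sides turn out to be connected, so there are exactly two
     components. *)
  exists ((vs G :\ c) :&: X), ((vs G :\ c) :\: X).
  have [|||||||u1 [u2 [v1 [v2 sp]]]] := @cut_split G wfG G3
    ((vs G :\ c) :&: X) ((vs G :\ c) :\: X) c e1 e2 cV e1E e2E.
  - move=> z; rewrite !inE; case: (z =P c) => [->|_] /=; first by rewrite cV !orbT.
    by case: (z \in vs G); case: (z \in X).
  - by rewrite !inE eqxx.
  - by rewrite !inE eqxx /= andbF.
  - by move=> z; rewrite !inE => /andP [_ ->].
  - by exists a; rewrite in_setI aS.
  - by exists b; rewrite in_setD bS andbT.
  - move=> g p q gE g1 g2 jg /setIP [pS pX] /setDP [qS /negP []].
    by apply: (hX g p q) => //; rewrite !inE negb_or g1 g2.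
  have spA := split_component wfG G3 sp.
  split=> //; first exact: (split_component wfG G3 (split_sym sp)).
    apply/eqP => AB; have := split_disj sp (split_u1 sp).
    by rewrite -AB (split_u1 sp).
  apply/subsetP => z zS; apply/setUP.
  by case zX: (z \in X); [left; apply/setIP|right; apply/setDP]; rewrite zX.
move=> A B tc; have [hV dAB Ax By hx] := two_components_cut tc.
have [|||||||u1 [u2 [v1 [v2 sp]]]] := @cut_split G wfG G3 A B c e1 e2 cV e1E e2E.
- move=> z; have := hV z; rewrite !inE orbA; case: (z =P c) => [->|_] /=.
    by rewrite cV orbT.
  by rewrite orbF.
- by have := hV c; rewrite !inE eqxx /=; case: (c \in A).
- by have := hV c; rewrite !inE eqxx /= => /esym /negbT; rewrite negb_or => /andP [].
- exact: dAB.
- exact: Ax.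
- exact: By.
- move=> g p q gE g1 g2 jg pA qB; apply: (hx g p q) => //.
  by rewrite !inE negb_or g1 g2.
have u12 := nondegenerate_ends wfG G3 Gcrit cV ndeg sp.
have v12 := nondegenerate_ends wfG G3 Gcrit cV ndeg (split_sym sp).
have cA2 := split_two_edges_to_side wfG G3 sp no_e0.
have cB2 := split_two_edges_to_side wfG G3 (split_sym sp) no_e0.
have side A' B' u1' u2' v1' v2' :
    vertex_two_edge_split A' B' c e1 e2 u1' u2' v1' v2' ->
    buildB A' c e1 e2 = extend (A' :|: [set c]) u1' u2' c.
  case=> _ _ _ dAB' _ _ j1 j2 u1A u2A v1B v2B _; rewrite /buildB.
  have dBA' z : z \in B' -> z \notin A' by move=> zB; apply: contraL zB; apply: dAB'.
  by rewrite (endinE j1 u1A (dBA' _ v1B)) (endinE j2 u2A (dBA' _ v2B)).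
rewrite (side _ _ _ _ _ _ sp) (side _ _ _ _ _ _ (split_sym sp)).
split; first exact: (split_piece wfG G3 Gcrit sp).
exact: (split_piece wfG G3 Gcrit (split_sym sp)).
Qed.
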